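(* Let $f_{r+1},\dots,f_n\in R[x_1,\dots,x_n]$ with $0\le r\le n-1$ be given, write $\mathbf{x}=(x_1,\dots,x_n)$, $f=(f_{r+1},\dots,f_n)$, $A=R[\mathbf{x}]/(f_{r+1},\dots,f_n)$ and $\overline{A}=A\otimes_R k$, and suppose that the ideal of $\overline{A}$ generated by the determinants of the $(n-r)\times(n-r)$ minors of the Jacobian matrix $\mathrm{Jac}_{\overline{f}}$ is $\overline{A}$. Fix an $n\times(n-r)$ matrix $P$ and $(n-r)\times(n-r)$ matrices $\Delta_{r+1},\dots,\Delta_n$ with entries in $R[\mathbf{x}]$ such that $$\mathrm{Jac}_f\cdot P\equiv \mathrm{Id}_{n-r}+\sum_{j=r+1}^n f_j\Delta_j \pmod{\pi},$$ and, for a column vector $\mathbf{S}=(S_{r+1},\dots,S_n)$ of variables, let $$G(\mathbf{S})=f^{\sigma}\bigl(\psi(\mathbf{x})+\psi(P)\mathbf{S}\bigr)-f^{p'}-\sum_{j=r+1}^n f_j^{p'}\psi(\Delta_j)\mathbf{S}.$$ Then the following hold. (1) The system $G(\mathbf{S})=0$ has a unique solution $\mathbf{s}$ in $(\pi R\langle\mathbf{x}\rangle)^{n-r}$, and the $\sigma$-semilinear endomorphism $\widehat{\phi}$ of $R\langle\mathbf{x}\rangle$ given by $\widehat{\phi}(\mathbf{x})=\psi(\mathbf{x})+\psi(P)\mathbf{s}$ lifts the $p'$-power map on $k[\mathbf{x}]$. (2) $\widehat{\phi}$ maps the ideal $(f_{r+1},\dots,f_n)$ into $(f_{r+1}^{p'},\dots,f_n^{p'})\subseteq(f_{r+1},\dots,f_n)$,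 hence induces a $\sigma$-semilinear endomorphism of $R\langle\mathbf{x}\rangle/(f_{r+1},\dots,f_n)$ that lifts the $p'$-power endomorphism on $k[\mathbf{x}]/(\overline{f_{r+1}},\dots,\overline{f_n})$.
   Context: $K$ is a finite extension of $\mathbb{Q}_p$ with valuation ring $R$, uniformiser $\pi$ and residue field $k$. $\sigma$ is an automorphism of $K$ inducing on $k$ the map $x\mapsto x^{p'}$, where $p'$ is a power of $p$. A bar denotes reduction modulo $\pi$. $R\langle\mathbf{x}\rangle=R\langle x_1,\dots,x_n\rangle$ is the subring of $R[[x_1,\dots,x_n]]$ of power series whose coefficients tend to $0$. $\mathrm{Jac}_f$ is the $(n-r)\times n$ matrix $(\partial f_i/\partial x_j)$. For $g$ with coefficients in $R$, $g^\sigma$ is obtained by applying $\sigma$ to the coefficients. $\psi$ is the $\sigma$-semilinear (i.e. a ring homomorphism acting as $\sigma$ on $R$) endomorphism of $R\langle\mathbf{x}\rangle$ with $\psi(x_i)=x_i^{p'}$; it is applied entrywise to vectors and matrices. $f^{\sigma}=(f_{r+1}^\sigma,\dots,f_n^\sigma)$ and $f^{p'}=(f_{r+1}^{p'},\dots,f_n^{p'})$ are column vectors. *)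

(* Defs.v *)
From HB Require Import structures.
From mathcomp Require Import all_boot all_order all_algebra all_field.
From mathcomp Require Import ring_quotient boolp mpoly.

Set Implicit Arguments.
Unset Strict Implicit.
Unset Printing Implicit Defensive.

Import Order.TTheory GRing.Theory Num.Theory.

Local Open Scope ring_scope.

(* Z_p is the projective limit of the rings Z/p^j: the residue modulo p^j is
   represented by its canonical representative in [0, p^j). The primality proof
   is an argument of the type because Z_p is a domain only for prime p. *)
Record padic_int (p : nat) (p_pr : prime p) := PadicInt {
  padic_res : nat -> int;
  padic_resP : forall j, padic_res j = (padic_res j.+1 %% p%:Z ^+ j)%Z }.

Section PadicIntegers.
Variables (p : nat) (p_pr : prime p).

Local Notation pp j := (p%:Z ^+ j).
Local Notation padic_int := (padic_int p_pr).
Implicit Types x y z : padic_int.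

HB.instance Definition _ := gen_eqMixin padic_int.
HB.instance Definition _ := gen_choiceMixin padic_int.

Lemma padic_ext (x y : padic_int) :
  (forall j, padic_res x j = padic_res y j) -> x = y.
Proof.
case: x y => [x hx] [y hy] /= /funext exy.
by case: _ / exy hy => hy; congr PadicInt; exact: Prop_irrelevance.
Qed.

Lemma padic_res_small (x : padic_int) j : (padic_res x j %% pp j)%Z = padic_res x j.
Proof. by rewrite [in RHS]padic_resP [in LHS]padic_resP modz_mod. Qed.

Lemma padic_resS (x : padic_int) j :
  (padic_res x j.+1 = padic_res x j %[mod pp j])%Z.
Proof. by rewrite padic_res_small -padic_resP. Qed.

Lemma modz_pow (a b : int) j :
  (a = b %[mod pp j.+1])%Z -> (a = b %[mod pp j])%Z.
Proof.
move=> /eqP; rewrite eqz_mod_dvd => h; apply/eqP; rewrite eqz_mod_dvd.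
by apply: dvdz_trans h; rewrite exprS dvdz_mull.
Qed.

Fact padic_mk_subproof (a : nat -> int) :
  (forall j, (a j.+1 = a j %[mod pp j])%Z) ->
  forall j, (a j %% pp j)%Z = ((a j.+1 %% pp j.+1)%Z %% pp j)%Z.
Proof.
by move=> ha j; rewrite -ha; apply/esym/modz_pow; rewrite modz_mod.
Qed.

Definition padic_mk (a : nat -> int)
    (ha : forall j, (a j.+1 = a j %[mod pp j])%Z) : padic_int :=
  PadicInt p_pr (padic_mk_subproof ha).

Fact padic_cst_subproof (c : int) j : (c = c %[mod pp j])%Z.
Proof. by []. Qed.

Definition padic_cst (c : int) : padic_int := padic_mk (padic_cst_subproof c).

Fact padic_add_subproof (x y : padic_int) j :
  (padic_res x j.+1 + padic_res y j.+1 = padic_res x j + padic_res y j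
    %[mod pp j])%Z.
Proof. by rewrite -modzDm !padic_resS modzDm. Qed.

Fact padic_opp_subproof (x : padic_int) j :
  (- padic_res x j.+1 = - padic_res x j %[mod pp j])%Z.
Proof. by rewrite -modzNm padic_resS modzNm. Qed.

Fact padic_mul_subproof (x y : padic_int) j :
  (padic_res x j.+1 * padic_res y j.+1 = padic_res x j * padic_res y j
    %[mod pp j])%Z.
Proof. by rewrite -modzMm !padic_resS modzMm. Qed.

Definition padic_add x y := padic_mk (padic_add_subproof x y).
Definition padic_opp x := padic_mk (padic_opp_subproof x).
Definition padic_mul x y := padic_mk (padic_mul_subproof x y).

Fact padic_addA : associative padic_add.
Proof. by move=> x y z; apply: padic_ext => j /=; rewrite modzDml modzDmr addrA. Qed.
Fact padic_addC : commutative padic_add.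
Proof. by move=> x y; apply: padic_ext => j /=; rewrite addrC. Qed.
Fact padic_add0 : left_id (padic_cst 0) padic_add.
Proof.
by move=> x; apply: padic_ext => j /=; rewrite modzDml add0r padic_res_small.
Qed.
Fact padic_addN : left_inverse (padic_cst 0) padic_opp padic_add.
Proof. by move=> x; apply: padic_ext => j /=; rewrite modzDml addNr. Qed.

HB.instance Definition _ := GRing.isZmodule.Build padic_int
  padic_addA padic_addC padic_add0 padic_addN.

Fact padic_mulA : associative padic_mul.
Proof. by move=> x y z; apply: padic_ext => j /=; rewrite modzMml modzMmr mulrA. Qed.
Fact padic_mulC : commutative padic_mul.
Proof. by move=> x y; apply: padic_ext => j /=; rewrite mulrC. Qed.
Fact padic_mul1 : left_id (padic_cst 1) padic_mul.
Proof.
by move=> x; apply: padic_ext => j /=; rewrite modzMml mul1r padic_res_small.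
Qed.
Fact padic_mulD : left_distributive padic_mul padic_add.
Proof.
by move=> x y z; apply: padic_ext => j /=; rewrite modzMml modzDml modzDmr mulrDl.
Qed.

Fact padic_oner_neq0 : padic_cst 1 != 0.
Proof.
apply/eqP => /(congr1 (fun x => padic_res x 1)) /=.
by rewrite mod0z modz_small // expr1 ltz_nat prime_gt1.
Qed.

HB.instance Definition _ := GRing.Zmodule_isComNzRing.Build padic_int
  padic_mulA padic_mulC padic_mul1 padic_mulD padic_oner_neq0.

Lemma padic_res0 j : padic_res 0 j = 0.
Proof. by rewrite /= mod0z. Qed.

Lemma padic_resM x y j :
  padic_res (x * y) j = ((padic_res x j * padic_res y j) %% pp j)%Z.
Proof. by []. Qed.

Lemma padic_res_le (x : padic_int) i j : (i <= j)%N ->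
  padic_res x i = (padic_res x j %% pp i)%Z.
Proof.
move=> /subnKC <-; elim: (j - i)%N => [|d ->]; first by rewrite addn0 padic_res_small.
have e := padic_resS x (i + d)%N; rewrite addnS; apply/esym.
move/eqP: e; rewrite eqz_mod_dvd => e; apply/eqP; rewrite eqz_mod_dvd.
by apply: dvdz_trans e; rewrite exprD dvdz_mulr.
Qed.

Fact padic_integral (x y : padic_int) : x * y = 0 -> (x == 0) || (y == 0).
Proof.
move=> xy0; have nz (z : padic_int) : z != 0 -> exists j, padic_res z j != 0.
  move=> z0; apply: contrapT => /forallNP h; move/eqP: z0; apply.
  by apply: padic_ext => j; rewrite padic_res0; apply/eqP/negPn/negP/h.
apply/norP => -[/nz[i xi] /nz[j yj]].
have := congr1 (fun z => padic_res z (i + j)) xy0.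
rewrite padic_res0 padic_resM => /dvdz_mod0P; rewrite dvdzE abszX absz_nat abszM.
move: xi yj; rewrite (padic_res_le x (leq_addr j i)) (padic_res_le y (leq_addl i j)).
move: (padic_res x _) (padic_res y _) => a b.
have ndv c m : (c %% pp m)%Z != 0 -> (0 < `|c|)%N && (logn p `|c| < m)%N.
  move=> /eqP cm; have c0 : (0 < `|c|)%N.
    by rewrite absz_gt0; apply/eqP => c0; apply: cm; rewrite c0 mod0z.
  rewrite c0 ltnNge -pfactor_dvdn //; apply/negP => h; apply: cm.
  by apply/dvdz_mod0P; rewrite dvdzE abszX.
move=> /ndv/andP[a0 ai] /ndv/andP[b0 bj].
rewrite pfactor_dvdn ?muln_gt0 ?a0 // lognM //.
move=> h; have := leq_trans (leq_add ai bj) h.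
by rewrite addSn addnS ltnNge leqnSn.
Qed.

Let padic_unit : {pred padic_int} := fun x => `[< exists y, y * x = 1 >].
Let padic_inv x : padic_int :=
  if pselect (exists y, y * x = 1) is left h then projT1 (cid h) else x.

Fact padic_mulVx : {in padic_unit, left_inverse 1 padic_inv *%R}.
Proof.
move=> x /asboolP xu; rewrite /padic_inv; case: pselect => // h.
by case: (cid h).
Qed.
Fact padic_unitPl x y : y * x = 1 -> padic_unit x.
Proof. by move=> yx; apply/asboolP; exists y. Qed.
Fact padic_invr_out : {in [predC padic_unit], padic_inv =1 id}.
Proof.
by move=> x /negP xu; rewrite /padic_inv; case: pselect => // h; case: xu; apply/asboolP.
Qed.

HB.instance Definition _ := GRing.ComNzRing_hasMulInverse.Build padic_int
  padic_mulVx padic_unitPl padic_invr_out.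
HB.instance Definition _ := GRing.ComUnitRing_isIntegral.Build padic_int
  padic_integral.

Definition padic_field := {fraction padic_int}.

End PadicIntegers.
(* [padic_val_is z j] : the p-adic valuation of z is j (never true for z = 0). *)
Definition padic_val_is (p : nat) (p_pr : prime p) (z : padic_int p_pr) (j : nat) :=
  padic_res z j = 0 /\ padic_res z j.+1 <> 0.

(* Normalised discrete valuations; the value at 0 is irrelevant. *)
Record discrete_valuation (K : fieldType) := DiscreteValuation {
  dval :> K -> int;
  dvalM : forall x y, x != 0 -> y != 0 -> dval (x * y) = dval x + dval y;
  dvalD : forall x y, x != 0 -> y != 0 -> x + y != 0 ->
    Num.min (dval x) (dval y) <= dval (x + y);
  dval_surj : exists2 x, x != 0 & dval x = 1 }.

(* v restricts to e * v_p on Z_p, hence on Q_p; e is the ramification index. *)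
Definition extends_padic (p : nat) (p_pr : prime p)
    (K : fieldExtType (padic_field p_pr)) (v : discrete_valuation K) :=
  exists2 e : nat, (0 < e)%N &
    forall (z : padic_int p_pr) j, padic_val_is z j ->
      v ((tofrac z)%:A) = (e * j)%:Z.

Section ValuationRing.
Variables (K : fieldType) (v : discrete_valuation K).

Definition val_ge (N : int) (x : K) := (x == 0) || (N <= v x).

Lemma val_ge0 N : val_ge N 0.
Proof. by rewrite /val_ge eqxx. Qed.

Lemma val_geD N x y : val_ge N x -> val_ge N y -> val_ge N (x + y).
Proof.
rewrite /val_ge; have [->|x0 /= Nx] := eqVneq x 0; first by rewrite add0r.
have [->|y0 /= Ny] := eqVneq y 0; first by rewrite addr0 Nx orbT.
have [//|xy0 /=] := eqVneq (x + y) 0.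
by apply: le_trans (dvalD v x0 y0 xy0); rewrite le_min Nx.
Qed.

Lemma val_geM N M x y : val_ge N x -> val_ge M y -> val_ge (N + M) (x * y).
Proof.
rewrite /val_ge; have [->|x0 /= Nx] := eqVneq x 0; first by rewrite mul0r eqxx.
have [->|y0 /= Ny] := eqVneq y 0; first by rewrite mulr0 eqxx.
by rewrite dvalM // lerD ?orbT.
Qed.

Lemma dval1 : v 1 = 0.
Proof.
by apply: (addrI (v 1)); rewrite -dvalM ?oner_neq0 // mulr1 addr0.
Qed.

Lemma dvalN1 : v (-1) = 0.
Proof.
have n0 : -1 != 0 :> K by rewrite oppr_eq0 oner_neq0.
have := dvalM v n0 n0; rewrite mulrNN mulr1 dval1 => /esym/eqP.
by rewrite -mulr2n mulrn_eq0 => /eqP.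
Qed.

Lemma val_geN N x : val_ge N x -> val_ge N (- x).
Proof.
move=> Nx; rewrite -mulN1r -[N]add0r; apply: val_geM => //.
by rewrite /val_ge dvalN1 lexx orbT.
Qed.

Lemma val_ge_le N M x : N <= M -> val_ge M x -> val_ge N x.
Proof. by rewrite /val_ge => NM /orP[->//|/(le_trans NM)->]; rewrite orbT. Qed.

Definition vint : {pred K} := val_ge 0.

Fact vint_subring : subring_closed vint.
Proof.
split=> [|x y vx vy|x y vx vy]; rewrite ?unfold_in.
- by rewrite /val_ge dval1 lexx orbT.
- exact: val_geD vx (val_geN vy).
- by have := val_geM vx vy; rewrite addr0.
Qed.

HB.instance Definition _ := GRing.isSubringClosed.Build K vint vint_subring.

Record vring := VRing { vring_val :> K; vring_valP : vring_val \in vint }.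

HB.instance Definition _ := [isSub for vring_val].
HB.instance Definition _ := [Choice of vring by <:].
HB.instance Definition _ := [SubChoice_isSubComNzRing of vring by <:].

Definition vmax : {pred vring} := fun x => val_ge 1 (val x).

Fact vmax_ideal : idealr_closed vmax.
Proof.
split=> [||a x y xm ym]; rewrite ?unfold_in ?rmorph0 ?val_ge0 //.
- by rewrite rmorph1 /val_ge oner_eq0 dval1.
- rewrite rmorphD rmorphM /=; apply: val_geD ym.
  by have := val_geM (vring_valP a) xm; rewrite add0r.
Qed.

HB.instance Definition _ := isIdealr.Build vring vmax vmax_ideal.

Definition residue_field := {ideal_quot vmax}.
HB.instance Definition _ := GRing.ComNzRing.on residue_field.

Definition residue : vring -> residue_field := \pi%qT.
HB.instance Definition _ :=
  GRing.RMorphism.copy residue (\pi%qT : vring -> residue_field).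

Lemma residue_eq0 x : (residue x == 0) = (x \in vmax).
Proof. by rewrite -[0](rmorph0 residue) /residue -Quotient.idealrBE subr0. Qed.

Lemma residueK (y : residue_field) : residue (repr y) = y.
Proof. exact: reprK. Qed.

Fact residue_inv_subproof (y : residue_field) : y != 0 -> exists z, z * y = 1.
Proof.
rewrite -[y]residueK; move: (repr y) => a; rewrite residue_eq0 => ma.
have a0 : val a != 0 by apply: contra ma => /eqP a0; rewrite unfold_in a0 val_ge0.
have va : v (val a) = 0.
  have := vring_valP a; rewrite unfold_in /val_ge (negPf a0) /= => va.
  move: ma; rewrite unfold_in /val_ge (negPf a0) /= -ltNge => va'.
  by apply/eqP; rewrite eq_le va andbT -ltzD1 add0r.
have b0 : (val a)^-1 != 0 by rewrite invr_eq0.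
have vb : (val a)^-1 \in vint.
  rewrite unfold_in /val_ge (negPf b0) /=.
  by have := dvalM v b0 a0; rewrite mulVf // dval1 va addr0 => <-.
exists (residue (VRing vb)); rewrite -rmorphM -[1](rmorph1 residue).
by congr residue; apply: val_inj; rewrite /= mulVf.
Qed.

Let residue_inv (y : residue_field) : residue_field :=
  if pselect (exists z, z * y = 1) is left h then projT1 (cid h) else 0.

Fact residue_mulVf y : y != 0 -> residue_inv y * y = 1.
Proof.
move=> /residue_inv_subproof yu; rewrite /residue_inv; case: pselect => // h.
by case: (cid h).
Qed.

Fact residue_inv0 : residue_inv 0 = 0.
Proof.
rewrite /residue_inv; case: pselect => // h; exfalso; case: h => z.
by move/eqP; rewrite mulr0 eq_sym oner_eq0.
Qed.

HB.instance Definition _ :=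
  GRing.ComNzRing_isField.Build residue_field residue_mulVf residue_inv0.

Definition uniformiser (x : vring) := val x != 0 /\ v (val x) = 1.

Definition vring_map (sigma : K -> K)
    (sigma_int : forall x, x \in vint -> sigma x \in vint) (a : vring) : vring :=
  VRing (sigma_int _ (vring_valP a)).

End ValuationRing.
(* A[[x_1, .., x_n]], by coefficients indexed by exponents. *)
Record mseries (n : nat) (A : comNzRingType) :=
  MSeries { mscoef : 'X_{1..n} -> A }.

Section MultivariateSeries.
Variables (n : nat) (A : comNzRingType).
Local Notation mseries := (mseries n A).
Implicit Types c d e : mseries.

HB.instance Definition _ := gen_eqMixin mseries.
HB.instance Definition _ := gen_choiceMixin mseries.

Lemma mseriesP c d : (forall m, mscoef c m = mscoef d m) -> c = d.
Proof. by case: c d => [c] [d] /= /funext ->. Qed.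

Definition mseries_of_mpoly (p : {mpoly A[n]}) : mseries := MSeries (fun m => p@_m).

Definition mseries_add c d := MSeries (fun m => mscoef c m + mscoef d m).
Definition mseries_opp c := MSeries (fun m => - mscoef c m).
Definition mseries_mul c d := MSeries (fun m =>
  \sum_(k : 'X_{1..n < (mdeg m).+1, (mdeg m).+1} | m == (k.1 + k.2)%MM)
     mscoef c k.1 * mscoef d k.2).

Fact mseries_addA : associative mseries_add.
Proof. by move=> c d e; apply: mseriesP => m /=; rewrite addrA. Qed.
Fact mseries_addC : commutative mseries_add.
Proof. by move=> c d; apply: mseriesP => m /=; rewrite addrC. Qed.
Fact mseries_add0 : left_id (mseries_of_mpoly 0) mseries_add.
Proof. by move=> c; apply: mseriesP => m /=; rewrite mcoeff0 add0r. Qed.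
Fact mseries_addN : left_inverse (mseries_of_mpoly 0) mseries_opp mseries_add.
Proof. by move=> c; apply: mseriesP => m /=; rewrite mcoeff0 addNr. Qed.

HB.instance Definition _ := GRing.isZmodule.Build mseries
  mseries_addA mseries_addC mseries_add0 mseries_addN.

(* The ring axioms are checked on truncations. *)
Let trunc b c : {mpoly A[n]} :=
  \sum_(m : 'X_{1..n < b}) mscoef c m *: 'X_[m].

Let trunc_eq b (p q : {mpoly A[n]}) := forall m, (mdeg m < b)%N -> p@_m = q@_m.

Let truncE b c m : (mdeg m < b)%N -> (trunc b c)@_m = mscoef c m.
Proof. exact: mcoeff_mpoly. Qed.

Let trunc_eqM b p p' q q' :
  trunc_eq b p p' -> trunc_eq b q q' -> trunc_eq b (p * q) (p' * q').
Proof.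
move=> pp qq m mb; rewrite !mcoeffM; apply: eq_bigr => k _.
by rewrite pp ?qq // (leq_trans (bmdeg _) mb).
Qed.

Let truncM b c d : trunc_eq b (trunc b (mseries_mul c d)) (trunc b c * trunc b d).
Proof.
move=> m mb; rewrite truncE // mcoeffM /=; apply: eq_bigr => k _.
by rewrite !truncE // (leq_trans (bmdeg _) mb).
Qed.

Let trunc_inj c d : (forall b, trunc_eq b (trunc b c) (trunc b d)) -> c = d.
Proof.
move=> h; apply: mseriesP => m; have := h (mdeg m).+1 m (ltnSn _).
by rewrite !truncE.
Qed.

Let trunc_refl b p : trunc_eq b p p. Proof. by []. Qed.

Let truncP b p : trunc_eq b (trunc b (mseries_of_mpoly p)) p.
Proof. by move=> m mb; rewrite truncE. Qed.

Fact mseries_mulA : associative mseries_mul.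
Proof.
move=> c d e; apply: trunc_inj => b m mb.
rewrite truncM // (trunc_eqM (trunc_refl _) (@truncM b d e)) // mulrA.
by rewrite truncM // (trunc_eqM (@truncM b c d) (trunc_refl _)).
Qed.
Fact mseries_mulC : commutative mseries_mul.
Proof. by move=> c d; apply: trunc_inj => b m mb; rewrite !truncM // mulrC. Qed.
Fact mseries_mul1 : left_id (mseries_of_mpoly 1) mseries_mul.
Proof.
move=> c; apply: trunc_inj => b m mb; rewrite truncM //.
by rewrite (trunc_eqM (@truncP b 1) (trunc_refl _)) // mul1r.
Qed.
Fact mseries_mulD : left_distributive mseries_mul mseries_add.
Proof.
move=> c d e; apply: mseriesP => m /=; rewrite -big_split /=.
by apply: eq_bigr => k _; rewrite mulrDl.
Qed.
Fact mseries_oner_neq0 : mseries_of_mpoly 1 != 0.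
Proof.
apply/eqP => /(congr1 (fun c => mscoef c 0%MM)) /eqP /=.
by rewrite mcoeff1 mcoeff0 eqxx oner_eq0.
Qed.

HB.instance Definition _ := GRing.Zmodule_isComNzRing.Build mseries
  mseries_mulA mseries_mulC mseries_mul1 mseries_mulD mseries_oner_neq0.

Fact mseries_of_mpoly_zmod : zmod_morphism mseries_of_mpoly.
Proof. by move=> p q; apply: mseriesP => m /=; rewrite mcoeffB. Qed.
Fact mseries_of_mpoly_monoid : monoid_morphism mseries_of_mpoly.
Proof. by split=> // p q; apply: mseriesP => m /=; rewrite mcoeffM. Qed.

HB.instance Definition _ := GRing.isZmodMorphism.Build
  {mpoly A[n]} mseries mseries_of_mpoly mseries_of_mpoly_zmod.
HB.instance Definition _ := GRing.isMonoidMorphism.Build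
  {mpoly A[n]} mseries mseries_of_mpoly mseries_of_mpoly_monoid.

End MultivariateSeries.

Section RestrictedSeries.
Variables (K : fieldType) (v : discrete_valuation K) (n : nat).
Local Notation R := (vring v).

(* the coefficients tend to 0 along the filter of cofinite sets of exponents *)
Definition restricted : {pred mseries n R} := fun c =>
  `[< forall N : nat, exists b : nat, forall m : 'X_{1..n},
        (b <= mdeg m)%N -> val_ge v N%:Z (val (mscoef c m)) >].

Fact restricted_mpoly p : mseries_of_mpoly p \in restricted.
Proof.
apply/asboolP => N; exists (msize p) => m mp /=.
by rewrite memN_msupp_eq0 ?val_ge0 //; apply/negP => /msize_mdeg_lt; rewrite ltnNge mp.
Qed.

Lemma val_ge_sum (I : finType) (P : pred I) (F : I -> R) N :
  (forall i, P i -> val_ge v N (val (F i))) -> val_ge v N (val (\sum_(i | P i) F i)).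
Proof.
move=> h; elim/big_ind: _ => // [|x y Nx Ny]; first by rewrite rmorph0 val_ge0.
by rewrite rmorphD val_geD.
Qed.

Fact restricted_subring : subring_closed restricted.
Proof.
split=> [|c d /asboolP hc /asboolP hd|c d /asboolP hc /asboolP hd].
- exact: (restricted_mpoly 1).
- apply/asboolP => N; have [[b hb] [b' hb']] := (hc N, hd N).
  exists (maxn b b') => m; rewrite geq_max => /andP[mb mb'] /=.
  by apply: val_geD; [exact: hb | apply: val_geN; exact: hb'].
- apply/asboolP => N; have [[b hb] [b' hb']] := (hc N, hd N).
  exists (b + b')%N => m mbb /=; apply: val_ge_sum => -[k l] /= /eqP/(congr1 mdeg).
  rewrite mdegD => mkl; rewrite {}mkl in mbb.
  have [bk|kb] := leqP b (mdeg k).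
    rewrite -[N%:Z]addr0; apply: val_geM; [exact: hb | exact: vring_valP].
  rewrite -[N%:Z]add0r; apply: val_geM; [exact: vring_valP | apply: hb'].
  by rewrite -(leq_add2l (mdeg k)) (leq_trans _ mbb) // leq_add2r ltnW.
Qed.

HB.instance Definition _ :=
  GRing.isSubringClosed.Build (mseries n R) restricted restricted_subring.

Record rseries := RSeries { rs_val :> mseries n R; rs_valP : rs_val \in restricted }.

HB.instance Definition _ := [isSub for rs_val].
HB.instance Definition _ := [Choice of rseries by <:].
HB.instance Definition _ := [SubChoice_isSubComNzRing of rseries by <:].

Definition rscoef (g : rseries) (m : 'X_{1..n}) : R := mscoef (val g) m.

Definition rs_of_mpoly (p : {mpoly R[n]}) : rseries := RSeries (restricted_mpoly p).

Fact rs_of_mpoly_zmod : zmod_morphism rs_of_mpoly.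
Proof. by move=> p q; apply: val_inj; rewrite rmorphB /= rmorphB. Qed.
Fact rs_of_mpoly_monoid : monoid_morphism rs_of_mpoly.
Proof.
by split=> [|p q]; apply: val_inj; rewrite ?rmorph1 ?rmorphM //=; exact: rmorphM.
Qed.

HB.instance Definition _ := GRing.isZmodMorphism.Build
  {mpoly R[n]} rseries rs_of_mpoly rs_of_mpoly_zmod.
HB.instance Definition _ := GRing.isMonoidMorphism.Build
  {mpoly R[n]} rseries rs_of_mpoly rs_of_mpoly_monoid.

Definition rsC (a : R) : rseries := rs_of_mpoly a%:MP.
Definition rsX (i : 'I_n) : rseries := rs_of_mpoly 'X_i.

Definition mpoly_at (y : 'cV[rseries]_n) (p : {mpoly R[n]}) : rseries :=
  mmap rsC (fun i => y i 0) p.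

(* Reduction R<x> -> k[x]: only finitely many coefficients have a nonzero
   residue, and b bounds their degrees. *)
Fact rsred_bound (g : rseries) :
  exists b : nat, forall m : 'X_{1..n}, (b <= mdeg m)%N -> residue (rscoef g m) = 0.
Proof.
have /asboolP/(_ 1%N)[b hb] := rs_valP g; exists b => m /hb h.
by apply/eqP; rewrite residue_eq0.
Qed.

Definition rsred (g : rseries) : {mpoly (residue_field v)[n]} :=
  \sum_(m : 'X_{1..n < projT1 (cid (rsred_bound g))}) residue (rscoef g m) *: 'X_[m].

Lemma mcoeff_rsred g m : (rsred g)@_m = residue (rscoef g m).
Proof.
rewrite /rsred; case: cid => b hb /=; have [mb|bm] := ltnP (mdeg m) b.
  exact: (mcoeff_mpoly (fun m => residue (rscoef g m))).
rewrite hb // raddf_sum /= big1 // => k _; rewrite mcoeffZ mcoeffX.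
by case: eqP => [e|]; rewrite ?mulr0 //; move: (bmdeg k); rewrite e ltnNge bm.
Qed.

Fact rsred_zmod : zmod_morphism rsred.
Proof.
by move=> g h; apply/mpolyP => m; rewrite mcoeffB !mcoeff_rsred -rmorphB.
Qed.
Fact rsred_monoid : monoid_morphism rsred.
Proof.
split=> [|g h]; apply/mpolyP => m.
  by rewrite mcoeff_rsred /rscoef /= mcoeff1 rmorph_nat mcoeff1.
rewrite mcoeffM mcoeff_rsred /rscoef /= rmorph_sum.
by apply: eq_bigr => k _; rewrite rmorphM !mcoeff_rsred.
Qed.

HB.instance Definition _ := GRing.isZmodMorphism.Build
  rseries {mpoly (residue_field v)[n]} rsred rsred_zmod.
HB.instance Definition _ := GRing.isMonoidMorphism.Build
  rseries {mpoly (residue_field v)[n]} rsred rsred_monoid.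

Lemma rsred_of_mpoly p : rsred (rs_of_mpoly p) = map_mpoly (@residue _ v) p.
Proof. by apply/mpolyP => m; rewrite mcoeff_rsred mcoeff_map_mpoly. Qed.

End RestrictedSeries.
(* Ideals given by generators, and the corresponding quotients. The library's
   {ideal_quot _} is a ring only for proper ideals; here the ideal may be the
   unit ideal, so the quotient is only a comPzRingType. *)
Section GeneratedIdeals.
Variables (T : comPzRingType) (S : T -> Prop).

Definition genideal : {pred T} := fun x =>
  `[< exists2 l : seq (T * T), (forall u, u \in l -> S u.2) &
        x = \sum_(u <- l) u.1 * u.2 >].

Lemma genidealM a x : x \in genideal -> a * x \in genideal.
Proof.
move=> /asboolP[l lS ->]; apply/asboolP; exists [seq (a * u.1, u.2) | u <- l].
  by move=> _ /mapP[u ul ->]; have := lS _ ul.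
by rewrite big_map mulr_sumr; apply: eq_bigr => u _; rewrite mulrA.
Qed.

Lemma genidealD x y : x \in genideal -> y \in genideal -> x + y \in genideal.
Proof.
move=> /asboolP[l lS ->] /asboolP[m mS ->]; apply/asboolP; exists (l ++ m).
  by move=> u; rewrite mem_cat => /orP[/lS|/mS].
by rewrite big_cat.
Qed.

Lemma genideal_gen x : S x -> x \in genideal.
Proof.
move=> Sx; apply/asboolP; exists [:: (1, x)]; last by rewrite big_seq1 mul1r.
by move=> u; rewrite inE => /eqP ->.
Qed.

Fact genideal_zmod : zmod_closed genideal.
Proof.
split=> [|x y xI yI]; first by apply/asboolP; exists [::]; rewrite ?big_nil.
by apply: genidealD => //; rewrite -mulN1r; exact: genidealM.
Qed.

HB.instance Definition _ := GRing.isZmodClosed.Build T genideal genideal_zmod.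

Definition quot_ring := Quotient.quot genideal.
HB.instance Definition _ := GRing.Zmodule.on quot_ring.

Definition qproj : T -> quot_ring := \pi%qT.
HB.instance Definition _ :=
  GRing.Additive.copy qproj (\pi%qT : T -> quot_ring).

Definition qrepr (y : quot_ring) : T := repr y.

Lemma qreprK : cancel qrepr qproj.
Proof. by move=> y; exact: reprK. Qed.

Lemma qproj_eq x y : (qproj x == qproj y) = (x - y \in genideal).
Proof. by rewrite Quotient.idealrBE. Qed.

Definition quot_mul (x y : quot_ring) := qproj (qrepr x * qrepr y).

Lemma qprojM : {morph qproj : x y / x * y >-> quot_mul x y}.
Proof.
move=> x y; apply/eqP; rewrite qproj_eq.
rewrite -[x * y](subrK (x * qrepr (qproj y))) -mulrBr -addrA -mulrBl.
rewrite [_ * qrepr _]mulrC; apply: genidealD; apply: genidealM;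
  by rewrite -qproj_eq qreprK.
Qed.

Fact quot_mulA : associative quot_mul.
Proof.
by move=> x y z; rewrite -[x]qreprK -[y]qreprK -[z]qreprK -!qprojM mulrA.
Qed.
Fact quot_mulC : commutative quot_mul.
Proof. by move=> x y; rewrite /quot_mul mulrC. Qed.
Fact quot_mul1 : left_id (qproj 1) quot_mul.
Proof. by move=> x; rewrite -[x]qreprK -qprojM mul1r. Qed.
Fact quot_mulD : left_distributive quot_mul +%R.
Proof.
move=> x y z; rewrite -[x]qreprK -[y]qreprK -[z]qreprK.
by rewrite -raddfD -!qprojM mulrDl raddfD.
Qed.

HB.instance Definition _ := GRing.Zmodule_isComPzRing.Build quot_ring
  quot_mulA quot_mulC quot_mul1 quot_mulD.

Fact qproj_monoid : monoid_morphism qproj.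
Proof. by split=> // x y; rewrite qprojM. Qed.
HB.instance Definition _ := GRing.isMonoidMorphism.Build T quot_ring qproj qproj_monoid.

End GeneratedIdeals.

Definition entries (T : Type) (m : nat) (f : 'cV[T]_m) : T -> Prop :=
  fun y => exists i, y = f i 0.

Definition jacobian (n m : nat) (A : comNzRingType) (f : 'cV[{mpoly A[n]}]_m) :
  'M[{mpoly A[n]}]_(m, n) := \matrix_(i, j) (f i 0)^`M(j).

Definition maximal_minor (A : comNzRingType) (m n : nat) (J : 'M[A]_(m, n)) (d : A) :=
  exists2 c : 'I_m -> 'I_n, {homo c : i j / (i < j)%N} & d = \det (colsub c J).

Definition mxred (K : fieldType) (v : discrete_valuation K) (n m l : nat)
    (M : 'M[{mpoly (vring v)[n]}]_(m, l)) : 'M[{mpoly (residue_field v)[n]}]_(m, l) :=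
  map_mx (map_mpoly (@residue K v)) M.

Section System.
Variables (K : fieldType) (v : discrete_valuation K) (n m : nat).
Local Notation R := (vring v).
Local Notation Rx := (rseries v n).
Local Notation emb := (map_mx (@rs_of_mpoly K v n)).
Implicit Types f : 'cV[{mpoly R[n]}]_m.

Definition powers f (q : nat) : 'cV[Rx]_m := \col_i rs_of_mpoly (f i 0) ^+ q.

Definition frob_point (psi : Rx -> Rx) (P : 'M[{mpoly R[n]}]_(n, m))
    (S : 'cV[Rx]_m) : 'cV[Rx]_n :=
  \col_i psi (rsX v i) + map_mx psi (emb P) *m S.

(* G as a map on column vectors over R<x>, with q standing for p'. *)
Definition Gsys (sigma : R -> R) (q : nat) (psi : Rx -> Rx) f
    (P : 'M[{mpoly R[n]}]_(n, m)) (Delta : 'I_m -> 'M[{mpoly R[n]}]_m)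
    (S : 'cV[Rx]_m) : 'cV[Rx]_m :=
  \col_i mpoly_at (frob_point psi P S) (map_mpoly sigma (f i 0))
  - powers f q
  - \sum_j powers f q j 0 *: (map_mx psi (emb (Delta j)) *m S).

(* R<x>/(f) and k[x]/(f mod pi) *)
Definition rs_quot f := quot_ring (entries (emb f)).
Definition res_quot f := quot_ring (entries (mxred f)).

(* The map induced by reduction; quot_redE shows that the choice of
   representative does not matter. *)
Definition quot_red f (y : rs_quot f) : res_quot f := qproj _ (rsred (qrepr y)).

Lemma quot_redE f g : quot_red (qproj _ g : rs_quot f) = qproj _ (rsred g).
Proof.
apply/eqP; rewrite qproj_eq -rmorphB.
have := qproj_eq (entries (emb f)) (qrepr (qproj (entries (emb f)) g)) g.
rewrite qreprK eqxx => /esym/asboolP[l lf ->].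
apply/asboolP; exists [seq (rsred u.1, rsred u.2) | u <- l].
  move=> _ /mapP[u /lf[i ->] ->] /=; exists i.
  by rewrite !mxE rsred_of_mpoly.
by rewrite rmorph_sum big_map; apply: eq_bigr => u _; rewrite rmorphM.
Qed.

End System.

Definition in_piRx (K : fieldType) (v : discrete_valuation K) (n m : nat)
    (pi : vring v) (s : 'cV[rseries v n]_m) :=
  forall i, exists t, s i 0 = rsC n pi * t.

(* compatibility with sigma on the constants; together with being a ring
   homomorphism this is sigma-semilinearity *)
Definition sigma_semilinear (K : fieldType) (v : discrete_valuation K) (n : nat)
    (sigma : vring v -> vring v) (phi : rseries v n -> rseries v n) :=
  forall a, phi (rsC n a) = rsC n (sigma a).

(* Main.v *)
(* Modulo pi, psi(g) = g^q for polynomials g, so the hypothesis on Jac_f * P says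
   that G has the identity as derivative at S = 0 modulo pi, and that G(0) = 0
   modulo pi. Since R, hence R<x>, is pi-adically complete, Newton's method gives
   a unique small root s. Completeness of R comes from that of Z_p: a sum of a
   complete Q_p-subspace W of K and a line not contained in W is complete,
   because W is closed. The map phi is the evaluation x |-> psi(x) + psi(P) s on
   polynomials, extended by continuity, and G(s) = 0 reads
   phi(f_i) = f_i^q + sum_j f_j^q (psi(Delta_j) s)_i. *)
Require Import Defs.
From HB Require Import structures.
From mathcomp Require Import all_boot all_order all_algebra all_field.
From mathcomp Require Import mpoly boolp zify ring.

Set Implicit Arguments.
Unset Strict Implicit.
Unset Printing Implicit Defensive.

Import Order.TTheory GRing.Theory Num.Theory.

Local Open Scope ring_scope.

(** * Completeness of finite extensions of Q_p *)

(** Everything rests on one estimate: if S and T lie in pi R<x> and agree modulo pi^N, then G(S) -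
    G(T) and S - T agree modulo pi^(N+1). It yields both uniqueness and the convergence of the
    iteration S -> S - G(S), so no derivative is ever inverted. By Taylor and the chain rule,
    f^sigma contributes psi(Jac_f P)(S - T) modulo pi^(N+1), that is S - T plus the terms psi(f_j)
    psi(Delta_j)(S - T). These need not be small; the last sum of G removes them, since psi(f_j) =
    f_j^q modulo pi. Its coefficients are f_j^q rather than psi(f_j) so that a root of G sends each
    f_i into the ideal of the q-th powers. Continuity of the ring maps is derived, not assumed:
    sigma induces the q-power map on k, so sigma(pi) has residue 0 and every semilinear endomorphism
    preserves each pi^N R<x>. *)

Section Fractions.
Import generic_quotient FracField.

Lemma fraction_repr (A : idomainType) (x : {fraction A}) :
  exists a b, b != 0 /\ x = tofrac a / tofrac b.
Proof.
elim/quotW: x => x; exists (frac x).1, (frac x).2; split; first exact: denom_ratioP.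
have dx : tofrac (frac x).2 != 0 by rewrite tofrac_eq0 denom_ratioP.
apply/(mulIf dx); rewrite mulfVK //; unlock tofrac; rewrite -[LHS]pi_mul.
apply/eqmodP; rewrite /= equivfE /mulf.
by rewrite !numden_Ratio ?mulf_neq0 ?oner_neq0 ?denom_ratioP // !mulr1 mulrC.
Qed.

End Fractions.

(** * Divisibility and units in Z_p *)

Section PadicIntegers.
Variables (p : nat) (p_pr : prime p).
Local Notation Zp := (padic_int p_pr).
Local Notation pp j := (p%:Z ^+ j).

Lemma pp_neq0 j : pp j != 0.
Proof. by rewrite expf_neq0 //; have := prime_gt0 p_pr; lia. Qed.

Lemma padic_val_exists (z : Zp) : z != 0 -> exists j, padic_val_is z j.
Proof.
move=> z0; have ex : exists j, padic_res z j != 0.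
  apply: contrapT => /forallNP h; move/eqP: z0; apply.
  by apply: padic_ext => j; rewrite padic_res0; apply/eqP/negPn/negP/h.
case: (ex_minnP ex) => -[|j] zj minj.
  by move: zj; rewrite -padic_res_small expr0 modz1 eqxx.
exists j; split; last exact/eqP.
by apply/eqP/negPn/negP => /minj; rewrite ltnn.
Qed.

Lemma padic_res_eq0_le (z : Zp) i j : (i <= j)%N ->
  padic_res z j = 0 -> padic_res z i = 0.
Proof. by move=> ij zj; rewrite (padic_res_le z ij) zj mod0z. Qed.

(** Division by p^j costs j digits, so the quotient modulo p^i is read off from [z] modulo
    p^(i+j). *)
Lemma padic_div (z : Zp) j : padic_res z j = 0 ->
  exists z', z = padic_cst p_pr (pp j) * z'.
Proof.
move=> zj; have dv i : (pp j %| padic_res z (i + j))%Z.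
  by apply/dvdz_mod0P; rewrite -padic_res_le // leq_addl.
have compat i : ((padic_res z (i.+1 + j) %/ pp j)%Z = (padic_res z (i + j) %/ pp j)%Z
    %[mod pp i])%Z.
  apply/eqP; rewrite eqz_mod_dvd -(dvdz_mul2r (pp_neq0 j)) mulrBl !divzK //.
  by rewrite -exprD -eqz_mod_dvd addSn padic_resS.
exists (padic_mk _ compat); apply: padic_ext => i.
rewrite padic_resM /= modzMml modzMmr mulrC divzK //.
by rewrite -padic_res_le // leq_addr.
Qed.

(** Bezout gives an inverse at each level; the chosen inverses are compatible because an inverse
    modulo p^i is unique. *)
Lemma padic_unitP (z : Zp) : padic_res z 1 <> 0 -> exists w, w * z = 1.
Proof.
move=> z1; have cop i : coprimez (padic_res z i) (pp i).
  case: i => [|i]; first by rewrite expr0 coprimezE coprimen1.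
  apply: coprimezXr; rewrite coprimezE coprime_sym prime_coprime //.
  apply/negP => h; apply: z1; rewrite (padic_res_le z (ltn0Sn i)) expr1.
  by apply/dvdz_mod0P; rewrite dvdzE.
have /choice[w wP] : forall i, exists w, (w * padic_res z i = 1 %[mod pp i])%Z.
  move=> i; have /coprimezP[[u t] /= <-] := cop i.
  by exists u; rewrite addrC modzMDl.
have compat i : (w i.+1 = w i %[mod pp i])%Z.
  apply/eqP; rewrite eqz_mod_dvd -(@Gauss_dvdzl _ _ (padic_res z i)); last first.
    by rewrite coprimez_sym.
  rewrite mulrBl -eqz_mod_dvd wP -modzMmr -padic_resS modzMmr.
  by apply/eqP/modz_pow/wP.
exists (padic_mk _ compat); apply: padic_ext => i.
by rewrite padic_resM /= modzMml wP.
Qed.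

Lemma padic_val_factor (z : Zp) j : padic_val_is z j ->
  exists u w : Zp, z = padic_cst p_pr (pp j) * u /\ w * u = 1.
Proof.
move=> [zj zj1]; have [u zu] := padic_div zj; exists u.
case: (@padic_unitP u); last by move=> w; exists w.
move=> u1; have [t ut] := padic_div u1; apply: zj1.
rewrite zu ut padic_resM /= !exprS expr0 mulr1.
by rewrite !modzMml !modzMmr mulrCA mulrA modzMr.
Qed.

Lemma padic_cstX (a b : nat) : padic_cst p_pr (pp (a + b)) =
  padic_cst p_pr (pp a) * padic_cst p_pr (pp b).
Proof. by apply: padic_ext => i; rewrite padic_resM /= modzMml modzMmr exprD. Qed.

End PadicIntegers.

(** * Cauchy sequences and limits for a discrete valuation *)

Section Valuations.
Variables (K : fieldType) (v : discrete_valuation K).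
Implicit Types (x y : K) (u w : nat -> K).

Lemma dvalV x : x != 0 -> v x^-1 = - v x.
Proof.
move=> x0; apply/eqP; rewrite -addr_eq0 -dvalM ?invr_eq0 //.
by rewrite mulVf ?dval1.
Qed.

Lemma val_ge_nat_eq0 x : (forall N : nat, val_ge v N%:Z x) -> x = 0.
Proof.
move=> h; apply/eqP/negPn/negP => x0; have := h `|v x|%N.+1.
by rewrite /val_ge (negPf x0) /=; lia.
Qed.

Lemma val_geB N x y : val_ge v N x -> val_ge v N y -> val_ge v N (x - y).
Proof. by move=> hx hy; apply: val_geD hx (val_geN hy). Qed.

Definition cauchy u := forall N : nat, exists M, forall i j,
  (M <= i)%N -> (M <= j)%N -> val_ge v N%:Z (u i - u j).

Definition converges u l := forall N : nat, exists M, forall i,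
  (M <= i)%N -> val_ge v N%:Z (l - u i).

Lemma cauchyB u w : cauchy u -> cauchy w -> cauchy (fun i => u i - w i).
Proof.
move=> cu cw N; have [[M hM] [M' hM']] := (cu N, cw N).
exists (maxn M M') => i j; rewrite !geq_max => /andP[Mi M'i] /andP[Mj M'j].
have -> : u i - w i - (u j - w j) = u i - u j - (w i - w j) by ring.
by apply: val_geB; [exact: hM | exact: hM'].
Qed.

Lemma convergesD u w l m :
  converges u l -> converges w m -> converges (fun i => u i + w i) (l + m).
Proof.
move=> cu cw N; have [[M hM] [M' hM']] := (cu N, cw N).
exists (maxn M M') => i; rewrite geq_max => /andP[Mi M'i].
by rewrite opprD addrACA; apply: val_geD; [exact: hM | exact: hM'].
Qed.

Lemma val_ge_scale (c : K) (N : nat) : exists N' : nat,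
  forall x, val_ge v N'%:Z x -> val_ge v N%:Z (c * x).
Proof.
have [->|c0] := eqVneq c 0; first by exists 0%N => x _; rewrite mul0r val_ge0.
(* The absolute value also covers a negative N - v(c), where no precision would be required. *)
exists `|N%:Z - v c|%N => x hx.
apply: (@val_ge_le _ _ _ (v c + `|N%:Z - v c|%N%:Z)); first by lia.
by apply: val_geM hx; rewrite /val_ge lexx orbT.
Qed.

Lemma cauchyZ c u : cauchy u -> cauchy (fun i => c * u i).
Proof.
move=> cu N; have [N' hN] := val_ge_scale c N; have [M hM] := cu N'.
by exists M => i j Mi Mj; rewrite -mulrBr; apply/hN/hM.
Qed.

Lemma convergesZ c u l : converges u l -> converges (fun i => c * u i) (c * l).
Proof.
move=> cu N; have [N' hN] := val_ge_scale c N; have [M hM] := cu N'.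
by exists M => i Mi; rewrite -mulrBr; apply/hN/hM.
Qed.

(** The rate of convergence is explicit so that it stays uniform when limits are taken coefficient
    by coefficient. *)
Definition complete_vring := forall u : nat -> vring v,
  (forall N : nat, val_ge v N%:Z (val (u N.+1 - u N))) ->
  exists l, forall N : nat, val_ge v N%:Z (val (l - u N)).

End Valuations.

(** * Completeness, from Z_p to Q_p to K *)

Section Completeness.
Variables (p : nat) (p_pr : prime p) (K : fieldExtType (padic_field p_pr)).
Variables (v : discrete_valuation K) (e : nat) (e_gt0 : (0 < e)%N).
Hypothesis v_padic : forall (z : padic_int p_pr) j, padic_val_is z j ->
  v ((tofrac z)%:A) = (e * j)%:Z.
Local Notation Zp := (padic_int p_pr).
Local Notation Qp := (padic_field p_pr).
Local Notation inK z := ((tofrac z)%:A : K).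

Lemma inK_eq0 (a : Qp) : (a%:A == 0 :> K) = (a == 0).
Proof. by rewrite scaler_eq0 oner_eq0 orbF. Qed.

Lemma val_ge_padic_res (z : Zp) j :
  val_ge v (e * j)%:Z (inK z) <-> padic_res z j = 0.
Proof.
have [->|z0] := eqVneq z 0; first by rewrite padic_res0 rmorph0 scale0r val_ge0.
have [i zi] := padic_val_exists z0; have [zi0 zi1] := zi.
rewrite /val_ge inK_eq0 tofrac_eq0 (negPf z0) /= (v_padic zi) lez_nat leq_pmul2l //.
split; first by move=> ji; apply: padic_res_eq0_le zi0.
by move=> zj; rewrite leqNgt; apply/negP => /padic_res_eq0_le/(_ zj).
Qed.

Lemma padic_int_of_val_ge0 (a : Qp) :
  val_ge v 0 (a%:A : K) -> exists z, a = tofrac z.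
Proof.
have [x [y [y0 ->]]] := fraction_repr a.
have [->|x0] := eqVneq x 0; first by exists 0; rewrite !rmorph0 mul0r.
have [[i xi] [j yj]] := (padic_val_exists x0, padic_val_exists y0).
have tx : tofrac x != 0 by rewrite tofrac_eq0.
have ty : tofrac y != 0 by rewrite tofrac_eq0.
rewrite /val_ge inK_eq0 mulf_eq0 invr_eq0 (negPf tx) (negPf ty) /=.
have -> : (tofrac x / tofrac y)%:A = inK x * (inK y)^-1.
  have yA : inK y != 0 by rewrite inK_eq0.
  by apply: (mulIf yA); rewrite mulfVK // -scalerAl mul1r scalerA mulfVK.
rewrite dvalM ?invr_eq0 ?inK_eq0 // dvalV ?inK_eq0 ?tofrac_eq0 //.
rewrite (v_padic xi) (v_padic yj) subr_ge0.
rewrite lez_nat leq_pmul2l // => ji.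
have [s [_ [xE _]]] := padic_val_factor xi.
have [t [w [yE wt]]] := padic_val_factor yj.
(* With x = p^i s, y = p^j t and w t = 1, this is x / y. *)
exists (padic_cst p_pr (p%:Z ^+ (i - j)) * s * w).
apply: (mulIf ty); rewrite mulfVK // -rmorphM; congr tofrac.
rewrite xE yE -[X in padic_cst _ (_ ^+ X) * s = _](subnK ji) padic_cstX.
rewrite -[LHS]mulr1 -wt; ring.
Qed.

(** The residues modulo each p^j are eventually constant, and these constants are the residues of
    the limit. *)
Lemma padic_int_complete (z : nat -> Zp) : cauchy v (fun i => inK (z i)) ->
  exists l, converges v (fun i => inK (z i)) (inK l).
Proof.
move=> cz; have /choice[M hM] : forall j, exists M, forall i k,
    (M <= i)%N -> (M <= k)%N -> padic_res (z i) j = padic_res (z k) j.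
  move=> j; have [M hM] := cz (e * j)%N; exists M => i k Mi Mk.
  have := hM i k Mi Mk; rewrite -scalerBl -rmorphB => /val_ge_padic_res /=.
  rewrite modzDmr => /dvdz_mod0P.
  by rewrite -eqz_mod_dvd => /eqP; rewrite !padic_res_small.
have lP j : padic_res (z (M j)) j = (padic_res (z (M j.+1)) j.+1 %% p%:Z ^+ j)%Z.
  rewrite (hM j _ (maxn (M j) (M j.+1))) ?leq_maxl // padic_resP.
  by congr (_ %% _)%Z; apply: hM; rewrite ?leq_maxr.
exists (PadicInt p_pr lP) => N; exists (M N) => i Mi.
apply: (@val_ge_le _ _ _ (e * N)%:Z); first by rewrite lez_nat leq_pmull.
rewrite -scalerBl -rmorphB; apply/val_ge_padic_res => /=.
by rewrite modzDmr (hM N i (M N)) // subrr mod0z.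
Qed.

(** From some index M on, the differences with [a M] have nonnegative valuation, hence lie in Z_p; a
    translation reduces the claim to Z_p. *)
Lemma padic_field_complete (a : nat -> Qp) : cauchy v (fun i => (a i)%:A) ->
  exists l : Qp, converges v (fun i => (a i)%:A) l%:A.
Proof.
move=> ca; have [M hM] := ca 0%N.
have /choice[z zE] : forall i, exists z, a (i + M)%N - a M = tofrac z.
  move=> i; apply: padic_int_of_val_ge0; rewrite scalerBl.
  by apply: hM; rewrite ?leq_addl.
have [|l hl] := @padic_int_complete z.
  move=> N; have [M' hM'] := ca N; exists M' => i j Mi Mj.
  rewrite -!zE -scalerBl opprB addrA subrK scalerBl.
  by apply: hM'; apply: leq_trans (leq_addr _ _).
exists (tofrac l + a M) => N; have [M' hM'] := hl N; exists (M' + M)%N => i Mi.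
have Mi' : (M <= i)%N := leq_trans (leq_addl _ _) Mi.
rewrite -(subnK Mi') -scalerBl -addrA -opprB zE scalerBl; apply: hM'.
by rewrite leq_subRL // addnC.
Qed.

Definition complete_in (W : {vspace K}) := forall u : nat -> K,
  (forall i, u i \in W) -> cauchy v u -> exists2 l, l \in W & converges v u l.

Lemma complete_addv (b : K) (W : {vspace K}) :
  b \notin W -> complete_in W -> complete_in (<[b]> + W)%VS.
Proof.
move=> bW cW.
(* W is complete, hence closed, so b has positive distance to it. *)
have [C hC] : exists C : nat, forall w, w \in W -> ~~ val_ge v C%:Z (b - w).
  apply: contrapT => /forallNP h.
  have /choice[w wP] : forall C : nat, exists w, w \in W /\ val_ge v C%:Z (b - w).
    move=> C; have /existsNP[w /not_implyP[wW /negP/negPn bw]] := h C.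
    by exists w.
  have [|N|l lW wl] := cW w; first by move=> i; case: (wP i).
    exists N => i j Ni Nj; have -> : w i - w j = b - w j - (b - w i) by ring.
    by apply: val_geB; [apply: val_ge_le (wP j).2 | apply: val_ge_le (wP i).2];
      rewrite lez_nat.
  case/negP: bW; suff -> : b = l by [].
  apply/eqP; rewrite -subr_eq0; apply/eqP/val_ge_nat_eq0 => N.
  have [M hM] := wl N; have [_ hw] := wP (maxn M N).
  have -> : b - l = b - w (maxn M N) - (l - w (maxn M N)) by ring.
  apply: val_geB; last by apply: hM; rewrite leq_maxl.
  by apply: val_ge_le hw; rewrite lez_nat leq_maxr.
(* For a nonzero, a b + w = a (b - w') with w' in W, so its valuation is less than v(a) + C. Reading
   off the coefficient of b thus loses at most C, and the coefficients of a Cauchy sequence are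
   again Cauchy. *)
have coef_bound (a : Qp) w (N : int) : w \in W -> val_ge v N (a *: b + w) ->
    val_ge v (N - C%:Z) (a%:A : K).
  move=> wW; have [->|a0] := eqVneq a 0; first by rewrite !scale0r val_ge0.
  have -> : a *: b + w = a%:A * (b - (- (a^-1 *: w))).
    by rewrite opprK mulr_algl scalerDr scalerA mulfV // scale1r.
  have := hC (- (a^-1 *: w)); rewrite rpredN rpredZ // => /(_ isT).
  rewrite /val_ge mulf_eq0 inK_eq0 (negPf a0) /= negb_or -ltNge => /andP[bw ltC].
  rewrite (negPf bw) dvalM ?inK_eq0 // => h.
  by rewrite lerBlDr (le_trans h) // lerD2l ltW.
move=> u uW cu.
have /choice[a /choice[w aw]] :
    forall i, exists a : Qp, exists w, w \in W /\ u i = a *: b + w.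
  move=> i; have /memv_addP[x /vlineP[a ->] [w wW ->]] := uW i.
  by exists a, w.
have ca : cauchy v (fun i => (a i)%:A).
  move=> N; have [M hM] := cu (N + C)%N; exists M => i j Mi Mj.
  rewrite -scalerBl.
  have -> : N%:Z = (N + C)%N%:Z - C%:Z by lia.
  apply: (@coef_bound _ (w i - w j)); first by rewrite rpredB ?(aw _).1.
  have := hM i j Mi Mj; rewrite !(aw _).2; congr val_ge.
  by rewrite scalerBl opprD addrACA.
have [l al] := padic_field_complete ca.
have wE i : w i = u i - b * (a i)%:A.
  by rewrite (aw i).2 mulr_algr addrAC subrr add0r.
have [|m mW wm] := cW w (fun i => (aw i).1).
  by rewrite (funext wE); apply: cauchyB => //; apply: cauchyZ.
exists (b * l%:A + m).
  by rewrite memv_add // mulr_algr; apply/vlineP; exists l.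
have -> : u = fun i => b * (a i)%:A + w i.
  by apply: funext => i; rewrite wE addrC subrK.
by apply: convergesD => //; apply: convergesZ.
Qed.

Lemma field_complete (u : nat -> K) : cauchy v u -> exists l, converges v u l.
Proof.
suff cs (X : seq K) : complete_in <<X>>%VS.
  move=> cu; have := cs (vbasis {:K}); rewrite (span_basis (vbasisP _)).
  by case/(_ u (fun i => memvf _) cu) => l _; exists l.
elim: X => [|b X IH].
  move=> w wW _; exists 0; first exact: mem0v.
  move=> N; exists 0%N => i _; have := wW i; rewrite span_nil memv0 => /eqP->.
  by rewrite subrr val_ge0.
rewrite span_cons; have [bX|bX] := boolP (b \in <<X>>%VS); last exact: complete_addv.
by rewrite (addv_idPr _) // -memvE.
Qed.

(** By the ultrametric inequality, increments of order N bound all later differences with [u N] by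
    the same order, so the limit inherits the rate without loss. *)
Lemma vring_complete : complete_vring v.
Proof.
move=> u hu; have tail (N i : nat) : (N <= i)%N -> val_ge v N%:Z (val (u i - u N)).
  move=> /subnK <-; elim: (i - N)%N => [|k IH]; first by rewrite add0n subrr val_ge0.
  rewrite addSn -[u _](subrK (u (k + N)%N)) -addrA rmorphD; apply: val_geD => //.
  by apply: val_ge_le (hu _); rewrite lez_nat leq_addl.
have [N|l hl] := @field_complete (fun i => val (u i)).
  exists N => i j Ni Nj; rewrite -rmorphB -[u i](subrK (u N)) -addrA rmorphD.
  by apply: val_geD; [exact: tail | rewrite -opprB rmorphN; apply/val_geN/tail].
have lN (N : nat) : val_ge v N%:Z (l - val (u N)).
  have [M hM] := hl N; rewrite -[l](subrK (val (u (maxn M N)))) -addrA -rmorphB.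
  by apply: val_geD; [apply: hM; rewrite leq_maxl | apply: tail; rewrite leq_maxr].
have lint : l \in vint v.
  by rewrite -[l](subrK (val (u 0%N))); apply: val_geD (lN 0%N) (vring_valP _).
by exists (VRing lint) => N; rewrite rmorphB; exact: lN.
Qed.

End Completeness.

(** * Restricted power series *)

(** Identities between ring maps and Leibniz-type estimates pass to sums and products, so this
    induction suits them better than one over monomials. *)
Lemma mpoly_ring_ind (n : nat) (A : comNzRingType) (Q : {mpoly A[n]} -> Prop) :
  (forall c, Q c%:MP) -> (forall i, Q 'X_i) ->
  (forall g h, Q g -> Q h -> Q (g + h)) -> (forall g h, Q g -> Q h -> Q (g * h)) ->
  forall g, Q g.
Proof.
move=> QC QX QD QM; have QX_ m : Q 'X_[m].
  rewrite mpolyXE_id; elim/big_ind: _ => [||i _]; [exact: (QC 1) | exact: QM |].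
  elim: (m i) => [|k IH]; first exact: (QC 1).
  by rewrite exprS; apply: QM.
elim/mpolyind => [|c m g _ _ Qg]; first by rewrite -mpolyC0.
by apply: QD Qg; rewrite -mul_mpolyC; apply: QM.
Qed.

Section RestrictedSeries.
Variables (K : fieldType) (v : discrete_valuation K) (n : nat).
Local Notation R := (vring v).
Local Notation Rx := (rseries v n).
Local Notation rsC := (@rsC K v n).
Local Notation rsX := (@rsX K v n).
Local Notation rs_of_mpoly := (@rs_of_mpoly K v n).
Implicit Types (g h : Rx) (N M : nat) (y : 'cV[Rx]_n).

Fact rsC_zmod : zmod_morphism rsC.
Proof. by move=> a b; rewrite /Defs.rsC !rmorphB. Qed.
Fact rsC_monoid : monoid_morphism rsC.
Proof. by split=> [|a b]; rewrite /Defs.rsC ?rmorph1 ?rmorphM. Qed.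
HB.instance Definition _ := GRing.isZmodMorphism.Build R Rx rsC rsC_zmod.
HB.instance Definition _ := GRing.isMonoidMorphism.Build R Rx rsC rsC_monoid.

HB.instance Definition _ (y : 'cV[Rx]_n) :=
  GRing.RMorphism.copy
    (@mpoly_at K v n y : {mpoly R[n]} -> Rx)
    (mmap rsC (fun i => y i 0) : {mpoly R[n]} -> Rx).

Lemma mpoly_atC y c : mpoly_at y c%:MP = rsC c.
Proof. exact: mmapC. Qed.

Lemma mpoly_atX y i : mpoly_at y 'X_i = y i 0.
Proof. by rewrite /mpoly_at mmapX mmap1U. Qed.

(* [rs_ge N g] says that [g] lies in pi^N R<x>, for any uniformiser pi. *)
Definition rs_ge N g := forall m, val_ge v N%:Z (val (rscoef g m)).

Lemma rscoef0 m : rscoef (0 : Rx) m = 0.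
Proof. exact: mcoeff0. Qed.

Lemma rscoefD g h m : rscoef (g + h) m = rscoef g m + rscoef h m.
Proof. by []. Qed.

Lemma rscoefN g m : rscoef (- g) m = - rscoef g m.
Proof. by []. Qed.

Lemma rsP g h : (forall m, rscoef g m = rscoef h m) -> g = h.
Proof. by move=> gh; apply/val_inj/mseriesP. Qed.

Lemma rs_ge_triv g : rs_ge 0 g.
Proof. by move=> m; exact: vring_valP. Qed.

Lemma rs_ge_zero N : rs_ge N 0.
Proof. by move=> m; rewrite rscoef0 rmorph0 val_ge0. Qed.

Lemma rs_geD N g h : rs_ge N g -> rs_ge N h -> rs_ge N (g + h).
Proof. by move=> hg hh m; rewrite rscoefD rmorphD; exact: val_geD (hg m) (hh m). Qed.

Lemma rs_geN N g : rs_ge N g -> rs_ge N (- g).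
Proof. by move=> hg m; rewrite rscoefN rmorphN; exact: val_geN (hg m). Qed.

Lemma rs_geB N g h : rs_ge N g -> rs_ge N h -> rs_ge N (g - h).
Proof. by move=> hg hh; apply: rs_geD hg (rs_geN hh). Qed.

Lemma rs_ge_sum (I : finType) N (F : I -> Rx) :
  (forall i, rs_ge N (F i)) -> rs_ge N (\sum_i F i).
Proof.
by move=> hF; elim/big_ind: _ => //; [exact: rs_ge_zero | move=> *; exact: rs_geD].
Qed.

Lemma rs_geM N M g h : rs_ge N g -> rs_ge M h -> rs_ge (N + M) (g * h).
Proof.
move=> hg hh m; rewrite /rscoef /=; apply: val_ge_sum => k _.
by rewrite PoszD; apply: val_geM; [exact: hg | exact: hh].
Qed.

Lemma rs_geMl N g h : rs_ge N h -> rs_ge N (g * h).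
Proof. exact: rs_geM (rs_ge_triv g). Qed.

Lemma rs_geMr N g h : rs_ge N g -> rs_ge N (g * h).
Proof. by rewrite mulrC; exact: rs_geMl. Qed.

Lemma rs_ge_le N M g : (N <= M)%N -> rs_ge M g -> rs_ge N g.
Proof. by move=> NM hg m; apply: val_ge_le (hg m); rewrite lez_nat. Qed.

Lemma rs_ge_eq0 g : (forall N, rs_ge N g) -> g = 0.
Proof.
move=> hg; apply: rsP => m; rewrite rscoef0; apply: val_inj.
by rewrite rmorph0; apply: val_ge_nat_eq0 => N; exact: hg.
Qed.

Lemma rs_ge1_red g : rs_ge 1 g <-> rsred g = 0.
Proof.
split=> [hg|g0 m]; first by apply/mpolyP => m; rewrite mcoeff_rsred mcoeff0;
  apply/eqP; rewrite residue_eq0; exact: hg.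
have := mcoeff_rsred g m; rewrite g0 mcoeff0 => /esym/eqP.
by rewrite residue_eq0.
Qed.

Lemma rs_geC N a : val_ge v N%:Z (val a) -> rs_ge N (rsC a).
Proof.
move=> ha m; rewrite [rscoef _ _]mcoeffC; case: eqP => _; first by rewrite mulr1.
by rewrite mulr0 rmorph0 val_ge0.
Qed.

(** Density of the polynomials: [h] truncates [g] at a degree beyond which all coefficients have
    valuation at least [N]. *)
Lemma rs_approx N g : exists h : {mpoly R[n]}, rs_ge N (g - rs_of_mpoly h).
Proof.
have /asboolP/(_ N)[b hb] := rs_valP g.
exists (\sum_(m : 'X_{1..n < b}) rscoef g m *: 'X_[m]) => m.
rewrite rscoefD rscoefN; have [mb|bm] := ltnP (mdeg m) b.
  rewrite [rscoef (rs_of_mpoly _) m](mcoeff_mpoly (fun m => rscoef g m)) //.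
  by rewrite subrr rmorph0 val_ge0.
rewrite [rscoef (rs_of_mpoly _) m](_ : _ = 0) ?subr0; first exact: hb.
rewrite [LHS]raddf_sum /= big1 // => k _; rewrite mcoeffZ mcoeffX.
by case: eqP => [e|]; rewrite ?mulr0 //; move: (bmdeg k); rewrite e ltnNge bm.
Qed.

Lemma rscoefCM a g m : rscoef (rsC a * g) m = a * rscoef g m.
Proof.
(* Coefficient [m] of a product involves only degrees up to [mdeg m], so [g] may be replaced by this
   truncation. *)
pose h : {mpoly R[n]} := \sum_(k : 'X_{1..n < (mdeg m).+1}) rscoef g k *: 'X_[k].
have hE k : (mdeg k < (mdeg m).+1)%N -> h@_k = rscoef g k.
  exact: (mcoeff_mpoly (fun m => rscoef g m)).
transitivity ((a%:MP * h)@_m); last by rewrite mcoeffCM hE.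
rewrite mcoeffM /rscoef /=; apply: eq_bigr => k _.
by rewrite hE //; exact: bmdeg.
Qed.

Section Uniformiser.
Variables (pi : R) (pi_unif : uniformiser pi).

Lemma val_pi : val_ge v 1 (val pi).
Proof. by rewrite /val_ge pi_unif.2 lexx orbT. Qed.

Lemma val_piX N : v (val pi ^+ N) = N%:Z.
Proof.
elim: N => [|N IH]; first by rewrite expr0 dval1.
by rewrite exprS dvalM ?expf_neq0 ?IH; case: pi_unif => // _ ->.
Qed.

Lemma val_ge_pi_dvd N (a : R) : val_ge v N%:Z (val a) ->
  exists b, a = pi ^+ N * b.
Proof.
have pi0 : val pi ^+ N != 0 by rewrite expf_neq0 //; case: pi_unif.
move=> ha; have hb : (val pi ^+ N)^-1 * val a \in vint v.
  have hV : val_ge v (- N%:Z) (val pi ^+ N)^-1.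
    by rewrite /val_ge dvalV // val_piX lexx orbT.
  by have := val_geM hV ha; rewrite addNr.
by exists (VRing hb); apply: val_inj; rewrite rmorphM rmorphXn /= mulVKf.
Qed.

Lemma rs_ge_pi_dvd N g : rs_ge N g -> exists h, g = rsC pi ^+ N * h.
Proof.
move=> hg; have /choice[h hE] : forall m, exists b : R, rscoef g m = pi ^+ N * b.
  by move=> m; exact: val_ge_pi_dvd (hg m).
have hr : MSeries h \in @restricted K v n.
  (* Dividing by pi^N lowers valuations by [N], hence the precision N + M asked of [g]. *)
  apply/asboolP => M; have /asboolP/(_ (N + M)%N)[b hb] := rs_valP g.
  exists b => m /hb; rewrite -[val_ge v _ _]/(val_ge v _ (val (rscoef g m))).
  have pi0 : val pi ^+ N != 0 by rewrite expf_neq0 //; case: pi_unif.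
  rewrite hE rmorphM rmorphXn /val_ge mulf_eq0 (negPf pi0) /=.
  have [//|h0 /=] := eqVneq (val (h m)) 0.
  by rewrite dvalM // val_piX PoszD lerD2l.
exists (RSeries hr); apply: rsP => m.
by rewrite -rmorphXn rscoefCM hE.
Qed.

Hypothesis R_complete : complete_vring v.

(** The coefficientwise limit is a restricted series because it agrees with [u N] modulo pi^N at all
    exponents at once. *)
Lemma rs_complete (u : nat -> Rx) : (forall N, rs_ge N (u N.+1 - u N)) ->
  exists l, forall N, rs_ge N (l - u N).
Proof.
move=> hu; have /choice[l hl] : forall m, exists l : R,
    forall N : nat, val_ge v N%:Z (val (l - rscoef (u N) m)).
  by move=> m; apply: R_complete => N; apply: hu.
have lr : MSeries l \in @restricted K v n.
  apply/asboolP => N; have /asboolP/(_ N)[b hb] := rs_valP (u N).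
  exists b => m /hb um; rewrite -[mscoef _ m](subrK (rscoef (u N) m)) rmorphD.
  exact: val_geD (hl m N) um.
by exists (RSeries lr) => N m; exact: hl.
Qed.

End Uniformiser.
End RestrictedSeries.

Lemma rmorphism_of (A B : pzRingType) (phi : A -> B) :
  zmod_morphism phi -> monoid_morphism phi ->
  exists psi : {rmorphism A -> B}, psi =1 phi.
Proof.
move=> phiZ phiM.
pose zM := GRing.isZmodMorphism.Build A B phi phiZ.
pose mM := GRing.isMonoidMorphism.Build A B phi phiM.
pose psi : {rmorphism A -> B} := HB.pack phi zM mM.
by exists psi.
Qed.

Lemma mpoly_expr_pcharD (n : nat) (F : comNzRingType) (p q : nat)
    (g h : {mpoly F[n]}) :
  p \in [pchar F] -> (exists a, q = (p ^ a)%N) -> (g + h) ^+ q = g ^+ q + h ^+ q.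
Proof.
move=> Fp [a ->]; have p_pr := pcharf_prime Fp; apply: exprDn_pchar.
by rewrite pnatX pnatE // inE p_pr /= -mpolyC_nat (pcharf0 Fp) mpolyC0 eqxx.
Qed.

(** * Semilinear endomorphisms of R<x> *)

Section Semilinear.
Variables (K : fieldType) (v : discrete_valuation K) (n : nat).
Local Notation R := (vring v).
Local Notation Rx := (rseries v n).
Local Notation rsC := (@rsC K v n).
Local Notation rsX := (@rsX K v n).
Local Notation rs_of_mpoly := (@rs_of_mpoly K v n).
Implicit Types (N : nat) (g : Rx).
Variables (pi : R) (pi_unif : uniformiser pi).
Variables (tau : {rmorphism R -> R}) (q : nat) (q_gt0 : (0 < q)%N).
Hypothesis tau_frob : forall a, residue (tau a) = residue a ^+ q.

(** The residue of [tau pi] is 0^q = 0, as q > 0, so [tau pi] has positive valuation and [tau] does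
    not lower the order of pi^N b. *)
Lemma val_ge_tau N (a : R) : val_ge v N%:Z (val a) -> val_ge v N%:Z (val (tau a)).
Proof.
move=> /(val_ge_pi_dvd pi_unif)[b ->].
have : val_ge v 1 (val (tau pi)).
  rewrite -[val_ge v _ _]/(tau pi \in @vmax K v) -residue_eq0 tau_frob.
  by rewrite expf_eq0 q_gt0 residue_eq0; exact: val_pi.
move=> hpi; rewrite rmorphM rmorphXn rmorphM rmorphXn -[N%:Z]addr0.
apply: val_geM (vring_valP _).
elim: N => [|N IH]; first by rewrite expr0 /val_ge dval1 orbT.
by rewrite exprS intS; apply: val_geM.
Qed.

Lemma semilinear_ge (phi : {rmorphism Rx -> Rx}) N g :
  sigma_semilinear tau phi -> rs_ge N g -> rs_ge N (phi g).
Proof.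
move=> phiC /(rs_ge_pi_dvd pi_unif)[h ->].
rewrite -rmorphXn rmorphM phiC; apply: rs_geMr; apply: rs_geC.
apply: val_ge_tau; rewrite rmorphXn /val_ge val_piX //.
by rewrite lexx orbT.
Qed.

Lemma semilinear_mpoly (phi : {rmorphism Rx -> Rx}) (h : {mpoly R[n]}) :
  sigma_semilinear tau phi ->
  phi (rs_of_mpoly h) = mpoly_at (\col_i phi (rsX i)) (map_mpoly tau h).
Proof.
move=> phiC; elim/mpoly_ring_ind: h => [c|i|g h eg eh|g h eg eh].
- by rewrite map_mpolyC mpoly_atC -phiC.
- by rewrite map_mpolyX mpoly_atX mxE.
- by rewrite !rmorphD eg eh.
- by rewrite !rmorphM eg eh.
Qed.

Lemma semilinear_unique (phi phi' : {rmorphism Rx -> Rx}) :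
  sigma_semilinear tau phi -> sigma_semilinear tau phi' ->
  (forall i, phi' (rsX i) = phi (rsX i)) -> phi' =1 phi.
Proof.
move=> phiC phiC' eX g; apply/eqP; rewrite -subr_eq0; apply/eqP/rs_ge_eq0 => N.
have [h gh] := rs_approx N g.
have e : phi (rs_of_mpoly h) = phi' (rs_of_mpoly h).
  by rewrite !semilinear_mpoly //; congr mpoly_at; apply/colP => i; rewrite !mxE.
have -> : phi' g - phi g = phi' (g - rs_of_mpoly h) - phi (g - rs_of_mpoly h).
  by rewrite !rmorphB e opprB addrA subrK.
by apply: rs_geB; apply: semilinear_ge.
Qed.

Lemma mpoly_at_ge (y : 'cV[Rx]_n) N (h : {mpoly R[n]}) :
  rs_ge N (rs_of_mpoly h) -> rs_ge N (mpoly_at y (map_mpoly tau h)).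
Proof.
move=> hN; rewrite /mpoly_at /mmap.
elim/big_ind: _ => [||m _]; [exact: rs_ge_zero | exact: rs_geD |].
apply: rs_geMr; apply: rs_geC; rewrite mcoeff_map_mpoly; exact: val_ge_tau (hN m).
Qed.

Hypothesis R_complete : complete_vring v.

(** The ring identities are proved for the relation [lift], where approximants can be chosen freely;
    they pass to a function picked by choice because [lift] determines the value. *)
Lemma semilinear_exists (y : 'cV[Rx]_n) : exists phi : {rmorphism Rx -> Rx},
  sigma_semilinear tau phi /\ forall i, phi (rsX i) = y i 0.
Proof.
pose ev h := mpoly_at y (map_mpoly tau h).
have evB h k : ev (h - k) = ev h - ev k by rewrite /ev !rmorphB.
have evD h k : ev (h + k) = ev h + ev k by rewrite /ev !rmorphD.
have evM h k : ev (h * k) = ev h * ev k by rewrite /ev !rmorphM.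
have ev1 : ev 1 = 1 by rewrite /ev !rmorph1.
have evC a : ev a%:MP = rsC (tau a) by rewrite /ev map_mpolyC mpoly_atC.
have evX i : ev 'X_i = y i 0 by rewrite /ev map_mpolyX mpoly_atX.
have ev_ge N h : rs_ge N (rs_of_mpoly h) -> rs_ge N (ev h) by exact: mpoly_at_ge.
clearbody ev.
(* [lift g l]: [l] is the value at [g] of the continuous extension of [ev]. *)
pose lift (g l : Rx) := forall N (h : {mpoly R[n]}),
  rs_ge N (g - rs_of_mpoly h) -> rs_ge N (l - ev h).
have lift_uniq g l l' : lift g l -> lift g l' -> l = l'.
  move=> gl gl'; apply/eqP; rewrite -subr_eq0; apply/eqP/rs_ge_eq0 => N.
  have [h gh] := rs_approx N g; rewrite -[l](subrK (ev h)) -addrA -[ev h - l']opprB.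
  by apply: rs_geB; [exact: gl | exact: gl'].
have lift_mpoly h : lift (rs_of_mpoly h) (ev h).
  by move=> N h'; rewrite -evB -rmorphB; exact: ev_ge.
have liftB g g' l l' : lift g l -> lift g' l' -> lift (g - g') (l - l').
  move=> gl gl' N h hN; have [h' gh'] := rs_approx N g'.
  have -> : l - l' - ev h = l - ev (h + h') - (l' - ev h').
    by rewrite evD; move: (ev h) (ev h') => a b; ring.
  apply: rs_geB; last exact: gl'.
  apply: gl; move: hN gh'; rewrite rmorphD /=.
  move: (rs_of_mpoly h) (rs_of_mpoly h') => a b ga gb.
  have -> : g - (a + b) = g - g' - a + (g' - b) by ring.
  exact: rs_geD.
have liftM g g' l l' : lift g l -> lift g' l' -> lift (g * g') (l * l').
  move=> gl gl' N h hN.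
  have [[k gk] [k' gk']] := (rs_approx N g, rs_approx N g').
  (* The last term is small because k k' and h both approximate g g'. *)
  have -> : l * l' - ev h =
      (l - ev k) * l' + ev k * (l' - ev k') + (ev (k * k' - h)).
    by rewrite evB evM; move: (ev h) (ev k) (ev k') => a b c; ring.
  apply: rs_geD; first apply: rs_geD.
  - exact/rs_geMr/gl.
  - exact/rs_geMl/gl'.
  apply: ev_ge; move: hN gk gk'; rewrite rmorphB rmorphM /=.
  move: (rs_of_mpoly h) (rs_of_mpoly k) (rs_of_mpoly k') => a b b' ga gb gb'.
  have -> : b * b' - a = g * g' - a - (g - b) * g' - b * (g' - b') by ring.
  by apply: rs_geB; [apply: rs_geB => //; exact: rs_geMr | exact: rs_geMl].
have /choice[phi phiP] : forall g, exists l, lift g l.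
  (* The value is the limit of [ev (h N)]: two polynomials close to [g] are close to each other, and
     [ev] keeps them so. *)
  move=> g; have /choice[h hP] := fun N => rs_approx N g.
  have diff_ge N (k k' : {mpoly R[n]}) : rs_ge N (g - rs_of_mpoly k) ->
      rs_ge N (g - rs_of_mpoly k') -> rs_ge N (ev k' - ev k).
    rewrite -evB => gk gk'; apply: ev_ge; rewrite rmorphB.
    by have := rs_geB gk gk'; rewrite opprB addrC addrA subrK.
  have [N|l hl] := rs_complete R_complete (u := fun N => ev (h N)).
    by apply: diff_ge => //; apply: rs_ge_le (hP _).
  exists l => N k gk; rewrite -[l](subrK (ev (h N))) -addrA.
  by apply: rs_geD => //; exact: diff_ge.
have phiE h : phi (rs_of_mpoly h) = ev h by apply: lift_uniq (lift_mpoly h).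
have [||psi psiE] := @rmorphism_of _ _ phi.
- by move=> g g'; apply: lift_uniq (liftB _ _ _ _ (phiP g) (phiP g')).
- split; first by rewrite -(rmorph1 rs_of_mpoly) phiE ev1 rmorph1.
  by move=> g g'; apply: lift_uniq (liftM _ _ _ _ (phiP g) (phiP g')).
by exists psi; split=> [a|i]; rewrite psiE phiE.
Qed.

Section Frobenius.
Variables (p : nat) (kp : p \in [pchar residue_field v]).
Hypothesis q_pow : exists a, q = (p ^ a)%N.

(** Since [phi] preserves pi R<x>, both sides depend only on [g] modulo pi, so [g] may be a
    polynomial. There both sides are ring maps, because k[x] has characteristic p, and they agree on
    constants and variables. *)
Lemma semilinear_frob (phi : {rmorphism Rx -> Rx}) :
  sigma_semilinear tau phi -> (forall i, rs_ge 1 (phi (rsX i) - rsX i ^+ q)) ->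
  forall g, rsred (phi g) = rsred g ^+ q.
Proof.
move=> phiC phiX g; have [h /[dup] gh /rs_ge1_red] := rs_approx 1 g.
rewrite rmorphB => /eqP; rewrite subr_eq0 => /eqP ->.
have /rs_ge1_red := semilinear_ge phiC gh.
rewrite !rmorphB /= => /eqP; rewrite subr_eq0 => /eqP ->.
elim/mpoly_ring_ind: h {g gh} => [c|i|g h eg eh|g h eg eh].
- rewrite (phiC c : phi (rs_of_mpoly _) = rs_of_mpoly (tau c)%:MP).
  rewrite !rsred_of_mpoly !map_mpolyC /=.
  by rewrite -rmorphXn; congr (_%:MP); exact: tau_frob.
- have /rs_ge1_red := phiX i.
  by rewrite rmorphB rmorphXn => /eqP; rewrite subr_eq0 => /eqP.
- by rewrite !rmorphD /= eg eh (mpoly_expr_pcharD _ _ kp q_pow).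
- by rewrite !rmorphM /= eg eh exprMn.
Qed.
End Frobenius.
End Semilinear.

(** * First-order Taylor expansion *)

Section Taylor.
Variables (K : fieldType) (v : discrete_valuation K) (n : nat).
Local Notation R := (vring v).
Local Notation Rx := (rseries v n).
Implicit Types (y z w : 'cV[Rx]_n) (h : {mpoly R[n]}).

Lemma rs_ge_mulB N (a b c d : Rx) :
  rs_ge N (a - b) -> rs_ge N (c - d) -> rs_ge N (a * c - b * d).
Proof.
have -> : a * c - b * d = (a - b) * c + b * (c - d) by ring.
by move=> ab cd; apply: rs_geD; [exact: rs_geMr | exact: rs_geMl].
Qed.

(* If S, T linearise a - b and c - d to order N + 1, the Leibniz rule does so
   for a * c - b * d; s and t are approximations modulo pi of b and c. *)
Lemma rs_ge_taylorM N (a b c d s t S T : Rx) :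
  rs_ge N.+1 (a - b - S) -> rs_ge N.+1 (c - d - T) ->
  rs_ge 1 (c - t) -> rs_ge 1 (b - s) -> rs_ge N S -> rs_ge N T ->
  rs_ge N.+1 (a * c - b * d - (S * t + s * T)).
Proof.
have -> : a * c - b * d - (S * t + s * T) =
  (a - b - S) * c + b * (c - d - T) + S * (c - t) + (b - s) * T by ring.
move=> abS cdT ct bs SN TN.
apply: rs_geD; last by rewrite -addn1 addnC; exact: rs_geM.
apply: rs_geD; last by rewrite -addn1; exact: rs_geM.
by apply: rs_geD; [exact: rs_geMr | exact: rs_geMl].
Qed.

Lemma rs_ge_taylorD N (a b c d S T : Rx) :
  rs_ge N (a - b - S) -> rs_ge N (c - d - T) -> rs_ge N (a + c - (b + d) - (S + T)).
Proof.
have -> : a + c - (b + d) - (S + T) = a - b - S + (c - d - T) by ring.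
exact: rs_geD.
Qed.

Lemma mpoly_at_cong N y z h : (forall i, rs_ge N (y i 0 - z i 0)) ->
  rs_ge N (mpoly_at y h - mpoly_at z h).
Proof.
move=> yz; elim/mpoly_ring_ind: h => [c|i|g h eg eh|g h eg eh].
- by rewrite !mpoly_atC subrr; exact: rs_ge_zero.
- by rewrite !mpoly_atX.
- by rewrite !rmorphD opprD addrACA; exact: rs_geD.
- by rewrite !rmorphM /=; exact: rs_ge_mulB.
Qed.

(** The derivatives are taken at a third point [w], so that one Jacobian serves all pairs y, z.
    Moving the base point changes the linear term by pi times pi^N, and y - z is divisible by both
    pi and pi^N, so quadratic terms are of order N + 1 as well. *)
Lemma mpoly_at_taylor N y z w h : (forall i, rs_ge N (y i 0 - z i 0)) ->
  (forall i, rs_ge 1 (y i 0 - w i 0)) -> (forall i, rs_ge 1 (z i 0 - w i 0)) ->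
  rs_ge N.+1 (mpoly_at y h - mpoly_at z h -
              \sum_j mpoly_at w h^`M(j) * (y j 0 - z j 0)).
Proof.
move=> yz yw zw; have lin_ge g :
    rs_ge N (\sum_j mpoly_at w g^`M(j) * (y j 0 - z j 0)).
  by apply: rs_ge_sum => j; apply: rs_geMl.
elim/mpoly_ring_ind: h => [c|i|g h eg eh|g h eg eh].
- rewrite !mpoly_atC subrr big1 ?subr0 => [|j _]; first exact: rs_ge_zero.
  by rewrite mderivC rmorph0 mul0r.
- rewrite !mpoly_atX (bigD1 i) //= big1 => [|j ji].
    rewrite addr0 mderivX mnmE eqxx scale1r.
    rewrite -[X in 'X_[X]](_ : 0%MM = _) ?mpolyX0 ?rmorph1 ?mul1r ?subrr.
      exact: rs_ge_zero.
    by apply/mnmP => k; rewrite mnmBE subnn mnm0E.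
  by rewrite mderivX mnmE eq_sym (negPf ji) scale0r rmorph0 mul0r.
- rewrite (eq_bigr (fun j => mpoly_at w g^`M(j) * (y j 0 - z j 0) +
     mpoly_at w h^`M(j) * (y j 0 - z j 0))) => [|j _].
    rewrite big_split /= (rmorphD (mpoly_at y)) (rmorphD (mpoly_at z)).
    exact: (rs_ge_taylorD eg eh).
  by rewrite mderivD rmorphD mulrDl.
- rewrite (eq_bigr (fun j => mpoly_at w g^`M(j) * (y j 0 - z j 0) * mpoly_at w h +
     mpoly_at w g * (mpoly_at w h^`M(j) * (y j 0 - z j 0)))) => [|j _].
    rewrite big_split /= -mulr_suml -mulr_sumr.
    rewrite (rmorphM (mpoly_at y)) (rmorphM (mpoly_at z)).
    have cy := mpoly_at_cong h yw; have bz := mpoly_at_cong g zw.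
    exact: (rs_ge_taylorM eg eh cy bz (lin_ge g) (lin_ge h)).
  by rewrite mderivM rmorphD !rmorphM /= mulrDl mulrAC mulrA.
Qed.

End Taylor.

(** * Roots of a map close to the identity *)

Section Hensel.
Variables (K : fieldType) (v : discrete_valuation K) (n m : nat).
Local Notation R := (vring v).
Local Notation Rx := (rseries v n).

Definition rsv_ge N (S : 'cV[Rx]_m) := forall i, rs_ge N (S i 0).

Lemma rsv_geD N S T : rsv_ge N S -> rsv_ge N T -> rsv_ge N (S + T).
Proof. by move=> hS hT i; rewrite mxE; exact: rs_geD. Qed.

Lemma rsv_geN N S : rsv_ge N S -> rsv_ge N (- S).
Proof. by move=> hS i; rewrite mxE; exact: rs_geN. Qed.

Hypothesis R_complete : complete_vring v.

Variable G : 'cV[Rx]_m -> 'cV[Rx]_m.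
Hypothesis G0 : rsv_ge 1 (G 0).
Hypothesis G_id : forall N S T, rsv_ge 1 S -> rsv_ge 1 T -> rsv_ge N (S - T) ->
  rsv_ge N.+1 (G S - G T - (S - T)).

(** If two roots agree modulo pi^N, then [G_id] with G(S) - G(T) = 0 makes them agree modulo
    pi^(N+1). *)
Lemma hensel_unique S T :
  rsv_ge 1 S -> rsv_ge 1 T -> G S = 0 -> G T = 0 -> S = T.
Proof.
move=> hS hT GS GT; suff ST N : rsv_ge N (S - T).
  apply/colP => i; apply/eqP; rewrite -subr_eq0; apply/eqP/rs_ge_eq0 => N.
  by have := ST N i; rewrite !mxE.
elim: N => [i|N IH]; first exact: rs_ge_triv.
have := G_id hS hT IH; rewrite GS GT subrr sub0r => /rsv_geN.
by rewrite opprK.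
Qed.

(* Newton's method with the derivative of [G] replaced by the identity. *)
Lemma hensel_exists : exists S, rsv_ge 1 S /\ G S = 0.
Proof.
pose u := fix u k := if k is k'.+1 then u k' - G (u k') else 0.
(* The step -G(u_k) cancels G(u_k) up to the error in [G_id], which is one order smaller; the count
   starts at 1 because of [G0]. *)
have uP k : rsv_ge 1 (u k) /\ rsv_ge k.+1 (G (u k)).
  elim: k => [|k [u1 Gu]]; first by split=> // i; rewrite mxE; exact: rs_ge_zero.
  have u1' : rsv_ge 1 (u k.+1).
    by apply: rsv_geD => // i; apply: (@rs_ge_le _ _ _ _ k.+1) => //; apply: rsv_geN.
  split=> //; have := @G_id k.+1 _ _ u1' u1.
  have -> : u k.+1 - u k = - G (u k) by rewrite /= addrAC subrr add0r.
  by rewrite opprK subrK; apply; exact: rsv_geN.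
have /choice[s sP] : forall i, exists l, forall N, rs_ge N (l - u N i 0).
  move=> i; apply: (rs_complete R_complete) => N.
  rewrite /= !mxE addrAC subrr add0r; apply: rs_geN.
  by apply: rs_ge_le ((uP N).2 i).
have su N : rsv_ge N (\col_i s i - u N) by move=> i; rewrite !mxE; exact: sP.
exists (\col_i s i); have s1 : rsv_ge 1 (\col_i s i).
  by rewrite -[\col_i _](subrK (u 1%N)); apply: rsv_geD (su 1%N) (uP 1%N).1.
split=> //; apply/colP => i; rewrite mxE; apply: rs_ge_eq0 => N.
have [uN GuN] := uP N.
have -> : G (\col_i s i) = G (\col_i s i) - G (u N) - (\col_i s i - u N) +
    (\col_i s i - u N + G (u N)).
  by rewrite addrA subrK subrK.
apply: rsv_geD; last apply: rsv_geD => //.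
  by move=> j; apply: rs_ge_le (G_id s1 uN (su N) j).
by move=> j; apply: rs_ge_le (GuN j).
Qed.

End Hensel.

(** * The system G(S) = 0 *)

Lemma padic_res_nat (p : nat) (p_pr : prime p) (k j : nat) :
  padic_res (k%:R : padic_int p_pr) j = (k%:Z %% p%:Z ^+ j)%Z.
Proof.
elim: k => [|k IH]; first by rewrite padic_res0 mod0z.
have resD (x y : padic_int p_pr) :
  padic_res (x + y) j = ((padic_res x j + padic_res y j) %% p%:Z ^+ j)%Z by [].
by rewrite mulrS resD IH [padic_res 1 j]/= modzDm intS.
Qed.

(** The integer p vanishes modulo p, so its valuation in K is at least e >= 1 and its residue is
    0. *)
Lemma residue_pchar (p : nat) (p_pr : prime p)
    (K : fieldExtType (padic_field p_pr)) (v : discrete_valuation K) :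
  extends_padic v -> p \in [pchar residue_field v].
Proof.
move=> [e e_gt0 v_padic]; rewrite inE p_pr -(rmorph_nat (@residue K v)).
rewrite residue_eq0 -[_ \in _]/(val_ge v 1 (val (p%:R : vring v))) rmorph_nat.
have -> : p%:R = (tofrac (p%:R : padic_int p_pr))%:A :> K.
  by rewrite rmorph_nat scaler_nat.
apply: (@val_ge_le _ _ _ (e * 1)%:Z); first by rewrite muln1; lia.
apply/(val_ge_padic_res e_gt0 v_padic).
by rewrite padic_res_nat expr1 modzz.
Qed.

Lemma mderiv_map_mpoly (n : nat) (A B : comNzRingType) (tau : {rmorphism A -> B})
    (h : {mpoly A[n]}) j : (map_mpoly tau h)^`M(j) = map_mpoly tau h^`M(j).
Proof.
elim/mpoly_ring_ind: h => [c|i|g h eg eh|g h eg eh].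
- by rewrite map_mpolyC !mderivC rmorph0.
- by rewrite map_mpolyX !mderivX map_mpolyZ map_mpolyX rmorph_nat.
- by rewrite rmorphD /= !mderivD rmorphD /= eg eh.
- by rewrite rmorphM /= !mderivM rmorphD !rmorphM /= eg eh.
Qed.

Section VringMap.
Variables (K : fieldType) (v : discrete_valuation K) (sigma : {rmorphism K -> K}).
Hypothesis sigma_int : forall x : K, x \in vint v -> sigma x \in vint v.

Fact vring_map_zmod : zmod_morphism (vring_map sigma_int).
Proof. by move=> a b; apply: val_inj; rewrite /= rmorphB. Qed.
Fact vring_map_monoid : monoid_morphism (vring_map sigma_int).
Proof. by split=> [|a b]; apply: val_inj; rewrite /= ?rmorph1 ?rmorphM. Qed.
HB.instance Definition _ := GRing.isZmodMorphism.Build (vring v) (vring v)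
  (vring_map sigma_int) vring_map_zmod.
HB.instance Definition _ := GRing.isMonoidMorphism.Build (vring v) (vring v)
  (vring_map sigma_int) vring_map_monoid.
End VringMap.

(** * Induced endomorphisms of quotients *)

Section Quotients.
Variables (T : comPzRingType) (S : T -> Prop) (phi : {rmorphism T -> T}).
Hypothesis phiS : forall x, S x -> phi x \in genideal S.

Lemma genideal_morph x : x \in genideal S -> phi x \in genideal S.
Proof.
move=> /asboolP[l lS ->]; rewrite rmorph_sum big_seq; apply: rpred_sum => u /lS uS.
by rewrite rmorphM; apply/genidealM/phiS.
Qed.

Lemma quot_morph_exists : exists theta : {rmorphism quot_ring S -> quot_ring S},
  forall x, theta (qproj S x) = qproj S (phi x).
Proof.
pose theta y := qproj S (phi (@qrepr T S y)).
have thetaE x : theta (qproj S x) = qproj S (phi x).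
  apply/eqP; rewrite qproj_eq -rmorphB; apply: genideal_morph.
  by rewrite -qproj_eq qreprK.
have [||psi psiE] := @rmorphism_of _ _ theta.
- by move=> y z; rewrite -[y]qreprK -[z]qreprK -rmorphB !thetaE -!rmorphB.
- split; first by rewrite -(rmorph1 (qproj S)) thetaE !rmorph1.
  by move=> y z; rewrite -[y]qreprK -[z]qreprK -rmorphM !thetaE -!rmorphM.
by exists psi => x; rewrite psiE.
Qed.

End Quotients.

(** Splits off the Taylor remainder of f^sigma: a and b are its values at two points, c the q-th
    powers, d and e the Delta sums, g the linear term, h = S - T. *)
Lemma col_regroup (m : nat) (A : comNzRingType) (a b c d e g h : 'cV[A]_m) :
  a - c - d - (b - c - e) - h = (a - b - g) + (g - (d - e) - h).
Proof. by apply/colP => i; rewrite !mxE; ring. Qed.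

Lemma col_cancel (m : nat) (A : comNzRingType) (a b c d : 'cV[A]_m) :
  a + b + c - d - a = b - d + c.
Proof. by apply/colP => i; rewrite !mxE; ring. Qed.

(** * The contraction estimate for G *)

Section Gsys.
Variables (K : fieldType) (v : discrete_valuation K) (n m : nat).
Local Notation R := (vring v).
Local Notation Rx := (rseries v n).
Local Notation rs_of_mpoly := (@rs_of_mpoly K v n).
Variables (pi : R) (pi_unif : uniformiser pi).
Variables (tau : {rmorphism R -> R}) (q : nat) (q_gt0 : (0 < q)%N).
Hypothesis tau_frob : forall a, residue (tau a) = residue a ^+ q.
Variables (p : nat) (kp : p \in [pchar residue_field v]).
Hypothesis q_pow : exists a, q = (p ^ a)%N.
Variables (f : 'cV[{mpoly R[n]}]_m) (P : 'M[{mpoly R[n]}]_(n, m)).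
Variables (Delta : 'I_m -> 'M[{mpoly R[n]}]_m) (E : 'M[{mpoly R[n]}]_m).
Hypothesis JP : jacobian f *m P = 1%:M + \sum_j f j 0 *: Delta j + pi%:MP *: E.
Variable psi : {rmorphism Rx -> Rx}.
Hypothesis psiC : sigma_semilinear tau psi.
Hypothesis psiX : forall i, psi (rsX v i) = rsX v i ^+ q.

Local Notation psi0 := (psi \o rs_of_mpoly).
Local Notation G := (Gsys tau q psi f P Delta).

Lemma rsv_geZ N M (a : Rx) (S : 'cV[Rx]_m) :
  rs_ge N a -> rsv_ge M S -> rsv_ge (N + M) (a *: S).
Proof. by move=> ha hS i; rewrite mxE; exact: rs_geM. Qed.

Lemma rsv_ge_mulmx l N (A : 'M[Rx]_(l, m)) (S : 'cV[Rx]_m) :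
  rsv_ge N S -> rsv_ge N (A *m S).
Proof. by move=> hS i; rewrite mxE; apply: rs_ge_sum => j; exact: rs_geMl. Qed.

Lemma rsv_ge_sum (I : finType) N (F : I -> 'cV[Rx]_m) :
  (forall i, rsv_ge N (F i)) -> rsv_ge N (\sum_i F i).
Proof. by move=> hF i; rewrite summxE; apply: rs_ge_sum => j; exact: hF. Qed.

Lemma psi_frob_ge (h : {mpoly R[n]}) : rs_ge 1 (psi0 h - rs_of_mpoly h ^+ q).
Proof.
apply/rs_ge1_red; apply/eqP; rewrite rmorphB subr_eq0 rmorphXn /=; apply/eqP.
apply: (semilinear_frob pi_unif q_gt0 tau_frob kp q_pow psiC) => i.
by rewrite psiX subrr; exact: rs_ge_zero.
Qed.

Lemma frob_pointB S T :
  frob_point psi P S - frob_point psi P T = map_mx psi0 P *m (S - T).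
Proof. by rewrite /frob_point opprD addrACA subrr add0r -map_mx_comp mulmxBr. Qed.

Lemma frob_point0 : frob_point psi P 0 = \col_i psi (rsX v i).
Proof. by rewrite /frob_point mulmx0 addr0. Qed.

(** By semilinearity f^sigma(psi(x)) = psi(f), which is f^q modulo pi. *)
Lemma Gsys0_ge : rsv_ge 1 (G 0).
Proof.
move=> i; rewrite /Gsys frob_point0 big1 => [|j _].
  rewrite subr0 !mxE -(semilinear_mpoly _ psiC); exact: psi_frob_ge.
by rewrite mulmx0 scaler0.
Qed.

(** Chain rule: the points differ by psi(P)(S - T), and the Jacobian of f^sigma at the common base
    point psi(x) is psi(Jac_f). *)
Lemma jacobian_taylor N S T : rsv_ge 1 S -> rsv_ge 1 T -> rsv_ge N (S - T) ->
  rsv_ge N.+1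
    (\col_i mpoly_at (frob_point psi P S) (map_mpoly tau (f i 0)) -
     \col_i mpoly_at (frob_point psi P T) (map_mpoly tau (f i 0)) -
     map_mx psi0 (jacobian f *m P) *m (S - T)).
Proof.
move=> S1 T1 DN i; rewrite map_mxM -mulmxA -frob_pointB.
set y := frob_point psi P S; set z := frob_point psi P T.
pose w : 'cV[Rx]_n := \col_i psi (rsX v i).
have coord (a b : 'cV[Rx]_n) k : a k 0 - b k 0 = (a - b) k 0 by rewrite !mxE.
have yz k : rs_ge N (y k 0 - z k 0).
  by rewrite coord frob_pointB; exact: rsv_ge_mulmx.
have yw k : rs_ge 1 (y k 0 - w k 0).
  by rewrite coord /w -frob_point0 frob_pointB subr0; exact: rsv_ge_mulmx.
have zw k : rs_ge 1 (z k 0 - w k 0).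
  by rewrite coord /w -frob_point0 frob_pointB subr0; exact: rsv_ge_mulmx.
have := mpoly_at_taylor (map_mpoly tau (f i 0)) yz yw zw.
rewrite (eq_bigr (fun j => map_mx psi0 (jacobian f) i j * (y - z) j 0)) => [|j _].
  by rewrite !mxE.
by rewrite coord mderiv_map_mpoly -(semilinear_mpoly _ psiC) !mxE.
Qed.

Lemma Gsys_contract N S T : rsv_ge 1 S -> rsv_ge 1 T -> rsv_ge N (S - T) ->
  rsv_ge N.+1 (G S - G T - (S - T)).
Proof.
move=> S1 T1 DN.
pose J := map_mx psi0 (jacobian f *m P).
rewrite /Gsys (@col_regroup _ _ _ _ _ _ _ (J *m (S - T))) /J.
apply: rsv_geD; first exact: jacobian_taylor.
move: DN; rewrite -sumrB.
under eq_bigr => j _ do rewrite -scalerBr -mulmxBr -map_mx_comp.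
move: (S - T) => D DN.
rewrite JP !map_mxD map_mx1 !mulmxDl mul1mx col_cancel.
rewrite raddf_sum /= mulmx_suml -sumrB.
(* What remains are the terms (psi(f_j) - f_j^q) psi(Delta_j) D and psi(pi E) D; each has a factor
   divisible by pi in front of D, which raises the order by one. *)
apply: rsv_geD.
  apply: rsv_ge_sum => j; rewrite map_mxZ -scalemxAl -scalerBl -[N.+1]add1n.
  by apply: rsv_geZ; [rewrite mxE; exact: psi_frob_ge | exact: rsv_ge_mulmx].
rewrite map_mxZ -scalemxAl -[N.+1]add1n.
apply: rsv_geZ; last exact: rsv_ge_mulmx.
(* [psi] sends pi to [tau pi], possibly another element, but still of positive valuation. *)
suff: rs_ge 1 (rsC n (tau pi)) by rewrite -psiC.
apply: rs_geC.
exact: (@val_ge_tau _ _ _ pi_unif tau q q_gt0 tau_frob 1) (val_pi pi_unif).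
Qed.

End Gsys.

Theorem theorem4p9
  (p : nat) (p_pr : prime p)
  (K : fieldExtType (padic_field p_pr))
  (v : discrete_valuation K) (v_padic : extends_padic v)
  (pi : vring v) (pi_unif : uniformiser pi)
  (q : nat) (q_pow : exists a : nat, q = (p ^ a)%N)
  (sigma : {rmorphism K -> K}) (sigma_bij : bijective sigma)
  (sigma_int : forall x : K, x \in vint v -> sigma x \in vint v)
  (sigma_frob : forall a : vring v,
    residue (vring_map sigma_int a) = residue a ^+ q)
  (n r : nat) (r_lt_n : (r < n)%N)
  (f : 'cV[{mpoly (vring v)[n]}]_(n - r))
  (f_smooth : forall y : res_quot f,
    y \in genideal (fun d => exists2 u,
      maximal_minor (jacobian (mxred f)) u & d = qproj (entries (mxred f)) u))
  (P : 'M[{mpoly (vring v)[n]}]_(n, n - r))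
  (Delta : 'I_(n - r) -> 'M[{mpoly (vring v)[n]}]_(n - r))
  (P_Delta : exists E : 'M[{mpoly (vring v)[n]}]_(n - r),
    jacobian f *m P = 1%:M + \sum_j f j 0 *: Delta j + pi%:MP *: E)
  (psi : {rmorphism rseries v n -> rseries v n})
  (psi_semilinear : sigma_semilinear (vring_map sigma_int) psi)
  (psi_X : forall i : 'I_n, psi (rsX v i) = rsX v i ^+ q) :
  exists s : 'cV[rseries v n]_(n - r),
    [/\ in_piRx pi s,
        Gsys (vring_map sigma_int) q psi f P Delta s = 0 &
        forall t, in_piRx pi t ->
          Gsys (vring_map sigma_int) q psi f P Delta t = 0 -> t = s]
    /\
    exists phi : {rmorphism rseries v n -> rseries v n},
      [/\ sigma_semilinear (vring_map sigma_int) phi,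
          forall i, phi (rsX v i) = frob_point psi P s i 0,
          forall phi' : {rmorphism rseries v n -> rseries v n},
            sigma_semilinear (vring_map sigma_int) phi' ->
            (forall i, phi' (rsX v i) = frob_point psi P s i 0) ->
            phi' =1 phi &
          forall g, rsred (phi g) = rsred g ^+ q]
      /\
      [/\ {in genideal (entries (map_mx (@rs_of_mpoly _ v n) f)), forall g,
            phi g \in genideal (entries (powers f q))},
          {subset genideal (entries (powers f q)) <=
            genideal (entries (map_mx (@rs_of_mpoly _ v n) f))} &
          exists theta : {rmorphism rs_quot f -> rs_quot f},
            [/\ forall g, theta (qproj _ g) = qproj _ (phi g),
                forall a, theta (qproj _ (rsC n a)) =
                          qproj _ (rsC n (vring_map sigma_int a)) &
                forall y, quot_red (theta y) = quot_red y ^+ q]].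
Proof.
have kp := residue_pchar v_padic.
have [e e_gt0 v_ext] := v_padic.
have Rc := @vring_complete _ _ _ _ _ e_gt0 v_ext.
have q_gt0 : (0 < q)%N by have [a ->] := q_pow; rewrite expn_gt0 prime_gt0.
have [E JP] := P_Delta.
(* Translates between multiples of pi and valuations of coefficients. *)
have piP k (t : 'cV[rseries v n]_k) : in_piRx pi t <-> rsv_ge 1 t.
  split=> tP i; last by have [h] := rs_ge_pi_dvd pi_unif (tP i); exists h.
  by have [h ->] := tP i; apply: rs_geMr; apply: rs_geC; exact: val_pi.
have G0 := Gsys0_ge pi_unif q_gt0 sigma_frob kp q_pow f P Delta psi_semilinear psi_X.
have Gc := Gsys_contract pi_unif q_gt0 sigma_frob kp q_pow JP psi_semilinear psi_X.
have [s [s1 Gs]] := hensel_exists Rc G0 Gc.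
exists s; split.
  split=> //; first exact/piP.
  by move=> t /piP t1 Gt; exact: hensel_unique Gc _ _ t1 s1 Gt Gs.
have [phi [phiC phiX]] :=
  semilinear_exists pi_unif q_gt0 sigma_frob Rc (frob_point psi P s).
have phi_frob : forall g, rsred (phi g) = rsred g ^+ q.
  apply: (semilinear_frob pi_unif q_gt0 sigma_frob kp q_pow phiC) => i.
  (* phi(x_i) differs from psi(x_i) = x_i^q by an entry of psi(P) s, which lies in pi R<x>. *)
  rewrite phiX /frob_point mxE [X in X + _ - _]mxE psi_X addrAC subrr add0r.
  exact: rsv_ge_mulmx.
exists phi; split.
  split=> // phi' phiC' phiX'.
  apply: (semilinear_unique pi_unif q_gt0 sigma_frob) => // i.
  by rewrite phiX phiX'.
have phi_f i : phi (rs_of_mpoly (f i 0)) \in genideal (entries (powers f q)).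
  (* By semilinearity phi(f_i) is f_i^sigma at phi(x), the very point at which G(s) evaluates it. *)
  rewrite (semilinear_mpoly _ phiC).
  have -> : \col_j phi (rsX v j) = frob_point psi P s.
    by apply/colP => j; rewrite mxE phiX.
  have /colP/(_ i) := Gs; rewrite !mxE => /eqP; rewrite subr_eq0 subr_eq => /eqP ->.
  rewrite summxE; apply: rpredD.
    apply: rpred_sum => j _; rewrite mxE mulrC; apply/genidealM/genideal_gen.
    by exists j.
  by apply: genideal_gen; exists i; rewrite mxE.
have powers_sub : {subset genideal (entries (powers f q)) <=
    genideal (entries (map_mx (@rs_of_mpoly _ v n) f))}.
  move=> _ /asboolP[l lS ->]; rewrite big_seq; apply: rpred_sum => u /lS[i ->].
  apply: genidealM; rewrite mxE -(prednK q_gt0) exprSr; apply/genidealM/genideal_gen.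
  by exists i; rewrite mxE.
have phi_I : {in genideal (entries (map_mx (@rs_of_mpoly _ v n) f)), forall g,
    phi g \in genideal (entries (powers f q))}.
  move=> _ /asboolP[l lS ->]; rewrite rmorph_sum big_seq.
  apply: rpred_sum => u /lS[i ->].
  by rewrite rmorphM mxE; apply: genidealM.
split=> //.
have [|theta thetaE] :=
  @quot_morph_exists _ (entries (map_mx (@rs_of_mpoly _ v n) f)) phi.
  by move=> x xS; apply/powers_sub/phi_I/genideal_gen.
exists theta; split=> // [a|y]; first by rewrite thetaE phiC.
rewrite -[y]qreprK thetaE.
by rewrite !quot_redE phi_frob rmorphXn.
Qed.
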